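(* For a connected graph $G$ with at least three vertices, the following conditions are equivalent: (i) $G$ is a partial double tree such that $G$ has a unique isometric embedding into the Cartesian product of two trees relative to minimality, permutations and automorphisms of the two trees; (ii) $G$ is a 2-connected median subgraph of the Cartesian product of two trees; (iii) $G$ is a median graph such that $\mathrm{Inc}(G)$ is bipartite and connected; (iv) $G$ is a median graph such that $\mathrm{Link}(x)$ is bipartite and connected for all vertices $x$ of $G$; (v) $G$ is a median graph such that $\mathrm{Link}(|G|)$ is bipartite and connected.
   Context: Graphs are simple, undirected and possibly infinite; a connected graph $G=(V,E)$ carries the shortest-path metric $d_G$. Subgraph relations are understood up to isomorphism. An induced subgraph of $G$ is an isometric subgraph if the distances between its vertices, computed inside it, coincide with those in $G$. The interval is $I(x,y)=\{z: d(x,y)=d(x,z)+d(z,y)\}$. $G$ is a median graph if $I(x,y)\cap I(y,z)\cap I(z,x)$ is a single vertex (the median of $x,y,z$) for all vertices $x,y,z$. A median subgraph of a median graph $H$ is an isometric subgraph of $H$ whose vertex set is closed under taking medians in $H$. A partial double tree is a graph that is isometrically embeddable into the Cartesian product $T_1\,\Box\,T_2$ of two trees (trees may be infinite). An isometric embedding $f:G\to T_1\,\Box\,T_2$ is minimal if both projections of $f(G)$ to $T_1$ and $T_2$ are onto. Uniqueness in (i) means: for any two minimal isometric embeddings $f:G\to T_1\,\Box\,T_2$ and $f':G\to T_1'\,\Box\,T_2'$ into products of two trees, there are a permutation $\sigma$ of $\{1,2\}$ and tree isomorphisms $\alpha_i:T_i\to T'_{\sigma(i)}$ such that $f'_{\sigma(i)}=\alpha_i\circ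 f_i$ for $i=1,2$, where $f_i,f'_i$ denote the coordinate maps. A set of vertices $Y$ is convex if $I(x,y)\subseteq Y$ for all $x,y\in Y$. A convex split of $G$ is a partition $\{A,B\}$ of $V$ into two nonempty convex sets. Two convex splits $\{A_1,B_1\}$, $\{A_2,B_2\}$ are incompatible if all four intersections $A_1\cap A_2$, $A_1\cap B_2$, $B_1\cap A_2$, $B_1\cap B_2$ are nonempty. The incompatibility graph $\mathrm{Inc}(G)$ has the convex splits of $G$ as vertices and the pairs of incompatible convex splits as edges. $|G|$ is the cubical complex obtained from $G$ by replacing all subgraphs isomorphic to cubes (vertices, edges, induced 4-cycles, 3-cubes, etc.) by solid unit cubes. For a vertex $x$, $\mathrm{Link}(x)$ is the graph whose vertices are the 1-cells (edges of $G$) containing $x$, two of them being adjacent iff they lie in a common 2-cell (i.e. a common 4-cycle of $G$). $\mathrm{Link}(|G|)$ is the union of the graphs $\mathrm{Link}(x)$ over all vertices $x$: its vertices are the edges of $G$, two of them being adjacent iff they share an endpoint and lie in a common 2-cell. *)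

(* Defs.v *)
From mathcomp Require Import all_boot.
From mathcomp Require Import boolp classical_sets.

Set Implicit Arguments.
Unset Strict Implicit.
Unset Printing Implicit Defensive.

Local Open Scope classical_set_scope.

Record sgraph := SGraph {
  vertex :> Type;
  adj : vertex -> vertex -> Prop;
  adj_sym : forall x y, adj x y -> adj y x;
  adj_irrefl : forall x, ~ adj x x }.

Fixpoint walk (G : sgraph) (n : nat) (x y : G) : Prop :=
  if n is n'.+1 then exists2 z, adj x z & walk n' z y else x = y.

(* The empty graph is not connected. *)
Definition connected (G : sgraph) : Prop :=
  (exists x : G, True) /\ forall x y : G, exists n, walk n x y.

Definition bipartite (G : sgraph) : Prop :=
  exists c : G -> bool, forall x y, adj x y -> c x <> c y.

Definition acyclic (G : sgraph) : Prop :=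
  forall (n : nat) (c : 'I_n -> G), 2 < n -> injective c ->
    ~ (forall i, adj (c i) (c (ordS i))).

(* A single vertex is a tree. *)
Definition tree (G : sgraph) : Prop := connected G /\ acyclic G.

(* The shortest-path metric. When no walk joins x and y the value is 0;
   the function is meant to be used on connected graphs only. *)
Definition dist (G : sgraph) (x y : G) : nat :=
  xget 0 [set n | walk n x y /\ forall m, walk m x y -> n <= m].

Definition interval (G : sgraph) (x y : G) : set G :=
  [set z | dist x y = dist x z + dist z y].

Definition medians (G : sgraph) (x y z : G) : set G :=
  interval x y `&` interval y z `&` interval z x.

Definition median_graph (G : sgraph) : Prop :=
  connected G /\ forall x y z : G, exists! m, medians x y z m.

(* A distance-preserving map is injective and preserves and reflects adjacency,
   so it identifies G with an isometric (hence induced) subgraph of H. *)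
Definition isometric_embedding (G H : sgraph) (f : G -> H) : Prop :=
  forall x y, dist (f x) (f y) = dist x y.

Definition isomorphism (G H : sgraph) (f : G -> H) : Prop :=
  bijective f /\ forall x y, adj (f x) (f y) <-> adj x y.

(* H is meant to be a median graph, so that medians in H are unique. *)
Definition median_subgraph (G H : sgraph) : Prop :=
  exists f : G -> H, isometric_embedding f /\
    forall x y z : H, range f x -> range f y -> range f z ->
      medians x y z `<=` range f.

Section Induced.
Variables (G : sgraph) (Y : set G).

Let iadj (x y : {x : G | Y x}) := adj (sval x) (sval y).

Fact iadj_sym x y : iadj x y -> iadj y x.
Proof. exact: adj_sym. Qed.

Fact iadj_irrefl x : ~ iadj x x.
Proof. exact: adj_irrefl. Qed.

Definition induced : sgraph := SGraph iadj_sym iadj_irrefl.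

End Induced.

Definition at_least_three_vertices (G : sgraph) : Prop :=
  exists x y z : G, [/\ x <> y, y <> z & x <> z].

Definition two_connected (G : sgraph) : Prop :=
  [/\ at_least_three_vertices G, connected G
    & forall v : G, connected (induced [set~ v])].

Section CartesianProduct.
Variables G H : sgraph.

Let padj (p q : G * H) :=
  (p.1 = q.1 /\ adj p.2 q.2) \/ (adj p.1 q.1 /\ p.2 = q.2).

Fact padj_sym p q : padj p q -> padj q p.
Proof. by case=> -[e h]; [left|right]; split=> //; apply: adj_sym. Qed.

Fact padj_irrefl p : ~ padj p p.
Proof. by case=> -[e h]; [apply: adj_irrefl h|apply: adj_irrefl e]. Qed.

Definition cartesian : sgraph := SGraph padj_sym padj_irrefl.

End CartesianProduct.

Definition partial_double_tree (G : sgraph) : Prop :=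
  exists T1 T2 : sgraph, [/\ tree T1, tree T2 &
    exists f : G -> cartesian T1 T2, isometric_embedding f].

Definition minimal_embedding (G T1 T2 : sgraph) (f : G -> cartesian T1 T2) :
    Prop :=
  [/\ isometric_embedding f,
      forall t : T1, exists x, (f x).1 = t
    & forall t : T2, exists x, (f x).2 = t].

(* The two disjuncts are the two permutations of the factors. *)
Definition equivalent_embeddings (G T1 T2 T1' T2' : sgraph)
    (f : G -> cartesian T1 T2) (f' : G -> cartesian T1' T2') : Prop :=
  (exists (a1 : T1 -> T1') (a2 : T2 -> T2'),
    [/\ isomorphism a1, isomorphism a2
      & forall x, (f' x).1 = a1 (f x).1 /\ (f' x).2 = a2 (f x).2])
  \/
  (exists (a1 : T1 -> T2') (a2 : T2 -> T1'),
    [/\ isomorphism a1, isomorphism a2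
      & forall x, (f' x).2 = a1 (f x).1 /\ (f' x).1 = a2 (f x).2]).

Definition unique_minimal_embedding (G : sgraph) : Prop :=
  forall T1 T2 T1' T2' : sgraph, tree T1 -> tree T2 -> tree T1' -> tree T2' ->
  forall (f : G -> cartesian T1 T2) (f' : G -> cartesian T1' T2'),
    minimal_embedding f -> minimal_embedding f' -> equivalent_embeddings f f'.

Definition convex (G : sgraph) (Y : set G) : Prop :=
  forall x y, Y x -> Y y -> interval x y `<=` Y.

(* A split is the unordered pair of its halves, as a set of sets. *)
Definition convex_split (G : sgraph) (S : set (set G)) : Prop :=
  exists A B : set G,
    [/\ S = [set A; B], A !=set0 /\ B !=set0, A `&` B = set0,
        A `|` B = setT & convex A /\ convex B].

Section Incompatibility.
Variable G : sgraph.

Let split := {S : set (set G) | convex_split S}.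

(* All four intersections of a half of S with a half of S' are nonempty. *)
Let incompatible (S S' : split) :=
  forall A A' : set G, sval S A -> sval S' A' -> A `&` A' !=set0.

Fact incompatible_sym S S' : incompatible S S' -> incompatible S' S.
Proof. by move=> h A A' SA SA'; rewrite setIC; apply: h. Qed.

Fact incompatible_irrefl S : ~ incompatible S S.
Proof.
move=> h; have [A [B [eS _ AB0 _ _]]] := svalP S.
by have := h A B; rewrite eS AB0 => /(_ (or_introl erefl) (or_intror erefl)) [].
Qed.

Definition Inc : sgraph := SGraph incompatible_sym incompatible_irrefl.

End Incompatibility.

(* Edges (1-cells) and 2-cells are given by their vertex sets; since a 2-cell is
   an induced 4-cycle, an edge lies in it iff both its ends do. *)
Definition edge (G : sgraph) (e : set G) : Prop :=
  exists x y, adj x y /\ e = [set x; y].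

Definition two_cell (G : sgraph) (C : set G) : Prop :=
  exists a b c d : G,
    [/\ C = [set a; b; c; d], a <> c /\ b <> d,
        [/\ adj a b, adj b c, adj c d & adj d a]
      & ~ adj a c /\ ~ adj b d].

Definition in_common_two_cell (G : sgraph) (e f : set G) : Prop :=
  exists C : set G, [/\ two_cell C, e `<=` C & f `<=` C].

Section Links.
Variable G : sgraph.

Let ladj x (e f : {e : set G | edge e /\ e x}) :=
  sval e <> sval f /\ in_common_two_cell (sval e) (sval f).

Fact ladj_sym x e f : @ladj x e f -> ladj f e.
Proof.
by case=> ne [C [hC eC fC]]; split; [exact: nesym|exists C].
Qed.

Fact ladj_irrefl x e : ~ @ladj x e e.
Proof. by case. Qed.

Definition Link (x : G) : sgraph := SGraph (@ladj_sym x) (@ladj_irrefl x).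

Let cadj (e f : {e : set G | edge e}) :=
  [/\ sval e <> sval f, sval e `&` sval f !=set0
    & in_common_two_cell (sval e) (sval f)].

Fact cadj_sym e f : cadj e f -> cadj f e.
Proof.
case=> ne ef [C [hC eC fC]].
by split; [exact: nesym|rewrite setIC|exists C].
Qed.

Fact cadj_irrefl e : ~ cadj e e.
Proof. by case. Qed.

(* The link graph of the whole cubical complex |G|: the union of all Link x. *)
Definition complex_Link : sgraph := SGraph cadj_sym cadj_irrefl.

End Links.

(* Main.v *)
(* Edge 2-colourings in which consecutive edges of every induced 4-cycle get
   different colours are exactly the proper colourings of Link(|G|), and they
   govern everything. Colouring an edge by the coordinate in which its ends
   differ turns an isometric embedding into a product of two trees into such a
   colouring; conversely, for a median graph, contracting all the edges of one
   colour gives a tree, and the two trees so obtained coordinatize the graph. Two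
   minimal embeddings are equivalent iff their colourings agree up to swapping the
   colours, so uniqueness means that Link(|G|) is connected. If G - v is
   disconnected, the edges on one side of v can be recoloured independently of the
   others. Connectedness of Inc(G), of G - x for all x and of all links are
   related through a vertex set separated by x which is obtained from a component
   of Link(x). *)
Require Import Defs.
From mathcomp Require Import all_boot.
From mathcomp Require Import boolp classical_sets.
From mathcomp Require Import zify.

Set Implicit Arguments.
Unset Strict Implicit.
Unset Printing Implicit Defensive.

Local Open Scope classical_set_scope.

(** * Distances, medians and halfspaces *)


(** Graphs may be infinite, so there is no induction on size; inductions run on distances and on
    lengths of walks. In a median graph a convex split is determined by any edge across it, and the
    edges across it are joined by ladders of squares, so a square colouring is constant on them.
    This is why a colouring of edges descends to [Inc G], and why each edge of a contracted graph is
    a bridge, which makes that graph a tree. Condition (i) speaks of isometric embeddings only,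
    whereas the other conditions speak of medians. The gap is closed by a fact special to two
    factors: a connected isometric subgraph of a product of two trees is closed under medians. With
    three factors this fails: the 3-cube minus a vertex is isometric in the product of three edges,
    but not median. *)

Section Walks.
Variable G : sgraph.
Implicit Types x y z : G.

Lemma walk_cat n m x y z : walk n x y -> walk m y z -> walk (n + m) x z.
Proof.
elim: n x => [|n IHn] x /=; first by move=> ->.
by case=> u xu uy yz; exists u => //; apply: IHn.
Qed.

Lemma walk_sym n x y : walk n x y -> walk n y x.
Proof.
elim: n x => [|n IHn] x /=; first by move=> ->.
case=> u xu /IHn uy; have ux : walk 1 u x by exists x => //; apply: adj_sym.
by have := walk_cat uy ux; rewrite addn1.
Qed.

Lemma walk_dist n x y : walk n x y -> walk (dist x y) x y /\ dist x y <= n.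
Proof.
move=> w; have ex : exists n, `[< walk n x y >] by exists n; apply/asboolP.
have [m /asboolP wm min] := ex_minnP ex.
have min' k : walk k x y -> m <= k by move=> wk; apply: min; apply/asboolP.
rewrite /dist; case: xgetP => [k _ [wk mk]|/(_ m) []]; last by split.
by split=> //; apply: mk.
Qed.

Lemma dist_le n x y : walk n x y -> dist x y <= n.
Proof. by case/walk_dist. Qed.

Lemma walk_path n x y : walk n x y ->
  exists p : nat -> G,
    [/\ p 0 = x, p n = y & forall i, i < n -> adj (p i) (p i.+1)].
Proof.
elim: n x => [|n IHn] x /=; first by move=> ->; exists (fun=> y).
case=> z xz /IHn[p [p0 pn pS]].
exists (fun i => if i is j.+1 then p j else x); split=> // -[|i] //=.
  by rewrite p0.
exact: pS.
Qed.

Lemma path_walk (p : nat -> G) i k :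
  (forall j, i <= j < i + k -> adj (p j) (p j.+1)) -> walk k (p i) (p (i + k)).
Proof.
elim: k i => [|k IHk] i h /=; first by rewrite addn0.
exists (p i.+1); first by apply: h; lia.
by rewrite addnS -addSn; apply: IHk => j hj; apply: h; lia.
Qed.

(** Connectedness as an induction principle: a property that spreads along edges reaches every
    vertex. In this form it applies to links, [Inc G] and vertex-deleted graphs without handling
    walks in subtypes. *)
Lemma connectedP : connected G <-> (exists x : G, True) /\
  forall P : G -> Prop, (forall x y, adj x y -> P x -> P y) ->
    forall x y, P x -> P y.
Proof.
split=> -[h0 h]; split=> //.
  move=> P hP x y; have [n] := h x y; elim: n x => [|n IHn] x /=.
    by move=> ->.
  by case=> z xz zy Px; apply: (IHn z zy); apply: hP Px.
move=> x y; apply: (h (fun y => exists n, walk n x y)); last by exists 0.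
move=> u v uv [n xu]; exists (n + 1); apply: walk_cat xu _.
by exists v.
Qed.

End Walks.

Section Metric.
Variables (G : sgraph) (hG : connected G).
Implicit Types x y z u v w : G.

Lemma dist_walk x y : walk (dist x y) x y.
Proof. by have [n /walk_dist[]] := hG.2 x y. Qed.

Lemma distxx x : dist x x = 0.
Proof. by apply/eqP; rewrite -leqn0; apply: dist_le. Qed.

Lemma dist_eq0 x y : dist x y = 0 -> x = y.
Proof. by move=> h; have := dist_walk x y; rewrite h. Qed.

Lemma dist_sym x y : dist x y = dist y x.
Proof.
by apply/eqP; rewrite eqn_leq !dist_le //; apply/walk_sym/dist_walk.
Qed.

Lemma dist_tri y x z : dist x z <= dist x y + dist y z.
Proof. by apply/dist_le/(walk_cat (dist_walk x y))/dist_walk. Qed.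

Lemma adj_neq x y : adj x y -> x <> y.
Proof. by move=> xy e; move: xy; rewrite e; apply: adj_irrefl. Qed.

Lemma adj_dist x y : adj x y -> dist x y = 1.
Proof.
move=> xy; have : dist x y <= 1 by apply: dist_le; exists y.
case e: (dist x y) => [|[|k]] // _.
by have := adj_neq xy (dist_eq0 e).
Qed.

Lemma dist_adj x y : dist x y = 1 -> adj x y.
Proof. by move=> h; have := dist_walk x y; rewrite h /= => -[z xz <-]. Qed.

Lemma dist_step x y n : dist x y = n.+1 -> exists2 z, adj x z & dist z y = n.
Proof.
move=> h; have := dist_walk x y; rewrite h /= => -[z xz wz]; exists z => //.
have := dist_tri z x y; rewrite h (adj_dist xz).
have := dist_le wz; lia.
Qed.

Lemma interval_sym x y : interval x y = interval y x.
Proof.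
apply/seteqP; split=> z; rewrite /interval /=;
by rewrite (dist_sym x y) (dist_sym x z) (dist_sym z y); lia.
Qed.

Lemma interval_trans x y z w : interval x y z -> interval x z w ->
  interval x y w /\ interval w y z.
Proof.
rewrite /interval /= => e1 e2.
by have := dist_tri w x y; have := dist_tri z w y; split; lia.
Qed.

Lemma interval_transr x y z w : interval x y z -> interval z y w ->
  interval x y w /\ interval x w z.
Proof.
rewrite /interval /= => e1 e2.
by have := dist_tri w x y; have := dist_tri z x w; split; lia.
Qed.

Lemma has_neighbour x : at_least_three_vertices G -> exists y, adj x y.
Proof.
case=> a [b [_ [ab _ _]]].
have [z xz] : exists z, x <> z.
  by case: (pselect (x = a)) => [->|]; [exists b|exists a].
case e: (dist x z) => [|n]; first by have := dist_eq0 e.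
by have [y] := dist_step e; exists y.
Qed.

End Metric.

(* In a median graph the non-adjacencies follow from the other conditions. *)
Definition square (G : sgraph) (a b c d : G) : Prop :=
  [/\ adj a b, adj b c, adj c d & adj d a] /\
  [/\ a <> c, b <> d, ~ adj a c & ~ adj b d].

(** The colouring is a symmetric function on all pairs, but only its values on edges matter.
    Comparing the first two edges suffices, since squares can be rotated. *)
Definition square_colouring (G : sgraph) (c : G -> G -> bool) : Prop :=
  (forall x y, c x y = c y x) /\
  forall x y z w, square x y z w -> c x y <> c y z.

Section Squares.
Variable G : sgraph.
Implicit Types x y z u v w : G.

Lemma square_rot x y z w : square x y z w -> square y z w x.
Proof.
move=> [[xy yz zw wx] [nxz nyw axz ayw]]; split; split=> //; first exact: nesym.
by move=> /adj_sym.
Qed.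

Lemma square_flip x y z w : square x y z w -> square z y x w.
Proof.
move=> [[xy yz zw wx] [nxz nyw axz ayw]].
by split; split=> //; do ?[exact: nesym | by apply: adj_sym | by move=> /adj_sym].
Qed.

Lemma square_opposite (c : G -> G -> bool) x y z w :
  square_colouring c -> square x y z w -> c x y = c w z.
Proof.
move=> [cs h] s; have h1 := h _ _ _ _ s.
have := h _ _ _ _ (square_rot s); rewrite (cs w z); move: h1.
by case: (c x y); case: (c y z); case: (c z w).
Qed.

End Squares.
Arguments square_flip {G x y z w}.
Arguments square_rot {G x y z w}.

Definition halfspace (G : sgraph) (A : set G) : Prop :=
  convex A /\ convex (~` A).

(** The set [W(x,y)] of Djokovic. In a median graph with [x], [y] adjacent it is a halfspace, and
    all convex splits arise in this way ([split_edge]). *)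
Definition nearer (G : sgraph) (x y : G) : set G :=
  [set z | dist z x < dist z y].

Section Median.
Variables (G : sgraph) (mG : median_graph G).
Implicit Types x y z u v w : G.

Let hG : connected G := mG.1.

Lemma median_ex x y z :
  exists m, [/\ interval x y m, interval y z m & interval x z m].
Proof.
have [m [[[mxy myz] mzx] _]] := mG.2 x y z; exists m; split=> //.
by rewrite (interval_sym hG).
Qed.

Lemma median_uniq x y z m m' :
  [/\ interval x y m, interval y z m & interval x z m] ->
  [/\ interval x y m', interval y z m' & interval x z m'] -> m = m'.
Proof.
have [m0 [_ mu]] := mG.2 x y z.
by case=> ? ? ? [? ? ?]; rewrite -(mu m) ?(mu m') //; split=> //;
  rewrite (interval_sym hG).
Qed.

(** The median of [x], [y], [z] is an end of the edge, and lies between the other end and [z].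
    Median graphs are thus bipartite. *)
Lemma adj_parity z x y : adj x y ->
  dist z x = (dist z y).+1 \/ dist z y = (dist z x).+1.
Proof.
move=> xy; have [m []] := median_ex x y z; 
rewrite /interval /= (adj_dist hG xy) (dist_sym hG m y).
rewrite -(dist_sym hG z x) -(dist_sym hG z y).
case e: (dist x m) => [|k]; first by rewrite (dist_eq0 hG e); lia.
case e': (dist y m) => [|k']; last by lia.
by rewrite (dist_eq0 hG e'); lia.
Qed.

Lemma triangle_free x y z : adj x y -> adj y z -> ~ adj x z.
Proof.
move=> xy yz /(adj_dist hG) xz; have := adj_dist hG xy.
by have [] := adj_parity x yz; lia.
Qed.

Lemma squareI x y z w : adj x y -> adj y z -> adj z w -> adj w x ->
  x <> z -> y <> w -> square x y z w.
Proof.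
move=> xy yz zw wx nxz nyw; split; split=> //; first exact: triangle_free yz.
exact: triangle_free zw.
Qed.

Lemma dist2 x y z : adj x y -> adj y z -> x <> z -> dist x z = 2.
Proof.
move=> xy yz nxz; have := adj_dist hG xy.
have [|->->//] := adj_parity x yz => h1 h2.
by rewrite h2 in h1; case: h1 => /esym/(dist_eq0 hG).
Qed.

(** The vertex [w] is the median of [y], [z] and [o]: since [y] and [z] are at distance 2 and
    equally far from [o], it is adjacent to both and one step nearer to [o]. *)
Lemma quadrangle o x y z : adj y x -> adj x z -> y <> z ->
  dist o x = (dist o y).+1 -> dist o x = (dist o z).+1 ->
  exists w, [/\ square y x z w, dist o y = (dist o w).+1
    & dist o z = (dist o w).+1].
Proof.
move=> yx xz nyz oy oz; have yz := dist2 yx xz nyz.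
have [w []] := median_ex y z o; rewrite /interval /= yz.
rewrite !(dist_sym hG _ o) (dist_sym hG w z) => h1 h2 h3.
have yw : dist y w = 1 by rewrite oy in oz; case: oz; lia.
have zw : dist z w = 1 by lia.
exists w; split; try lia; apply: squareI => //.
- exact: dist_adj.
- by apply/adj_sym/dist_adj.
- by move=> e; rewrite -e in h3 h2 *; lia.
Qed.

(* Both medians below coincide: q for u, v, x is a median of u, v, y on the side
   of x, whereas a vertex w of I(u,v) on the other side would produce one on the
   side of y. *)
Lemma nearer_convex x y : adj x y -> convex (nearer x y).
Proof.
move=> xy u v ux vx w uwv; rewrite /nearer /=.
case: ltnP => // wy; exfalso.
have S := interval_sym hG.
have near a : nearer x y a -> interval a y x.
  rewrite /nearer /interval /= (adj_dist hG xy).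
  by have [] := adj_parity a xy; lia.
have wyx : interval w x y.
  rewrite /interval /= (adj_dist hG (adj_sym xy)).
  by have [] := adj_parity w xy; lia.
have [q [q1 q2 q3]] := median_ex u v x.
have [r [r1 r2 r3]] := median_ex u w y.
have [t [t1 t2 t3]] := median_ex r v y.
have [uq qyx] := interval_trans hG (near _ ux) q3.
have [vq _] := interval_trans hG (near _ vx) q2.
have [ur _] := interval_trans hG uwv r1.
have [_ ryx] := interval_trans hG wyx r2.
have [_ tyx] := interval_trans hG ryx t3.
have [tuv _] := interval_transr hG ur t1.
have [tuy _] := interval_transr hG r3 t3.
have eqt : q = t by apply: (@median_uniq u v y).
subst t; move: qyx tyx (adj_dist hG xy); rewrite /interval /= (dist_sym hG y x); lia.
Qed.

(* Successive squares crossing the same split form a ladder from one crossing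
   edge to any other. *)
Lemma ladder (A : set G) (P : G -> G -> Prop) x y x' y' : halfspace A ->
  (forall u v u' v', square u v v' u' ->
    A u -> A u' -> ~ A v -> ~ A v' -> P u v -> P u' v') ->
  adj x y -> A x -> ~ A y -> adj x' y' -> A x' -> ~ A y' -> P x y -> P x' y'.
Proof.
move=> [cA cB] step xy Ax By xy' Ax' By'.
have S := dist_sym hG.
have cross u v t : adj u v -> A u -> ~ A v -> A t -> dist t v = (dist t u).+1.
  move=> uv Au Bv At; case: (adj_parity t uv) => // e; case: Bv.
  apply: (cA _ _ Au At); rewrite /interval /= (adj_dist hG uv) !(S _ t); lia.
have cross' u v t : adj u v -> A u -> ~ A v -> ~ A t -> dist t u = (dist t v).+1.
  move=> uv Au Bv Bt; case: (adj_parity t uv) => // e; case: (cB _ _ Bv Bt u _ Au).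
  rewrite /interval /= (adj_dist hG (adj_sym uv)) !(S _ t); lia.
move ed: (dist x x') => d; elim: d x y ed xy Ax By => [|n IHn] x y e xy Ax By Pxy.
  have xx' := dist_eq0 hG e; rewrite -xx' in xy' *.
  have := cross' _ _ _ xy' Ax By' By; rewrite S (adj_dist hG xy) => -[] /esym yy'.
  by rewrite -(dist_eq0 hG yy').
have [x2 xx2 e2] := dist_step hG e.
have Ax2 : A x2.
  by apply: (cA _ _ Ax Ax'); rewrite /interval /= e (adj_dist hG xx2) e2.
have h1 := cross _ _ _ xy' Ax' By' Ax.
have h2 := cross _ _ _ xy' Ax' By' Ax2.
have h3 := cross' _ _ y' xy Ax By By'.
have yx2 : y <> x2 by move=> h; rewrite h in By.
have h4 := dist2 (adj_sym xy) xx2 yx2.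
(* The next rung is [x2 m]. Both [x2] and [y] are at distance [n.+1] from [y'] and 2 apart, so the
   median is adjacent to both; it avoids [A] because it lies between [y] and [y']. *)
have [m []] := median_ex x2 y y'.
rewrite /interval /= => m1 m2 m3.
rewrite (S y m) (S x2 y) h4 (S y y') in m1 m2 m3.
rewrite (S x y') in h1.
have mx2 : dist x2 m = 1 by lia.
have my : dist m y = 1 by lia.
have Bm : ~ A m by apply: (cB y y') => //; rewrite /interval /= (S y m) (S y y').
apply: (IHn x2 m) => //; first exact: (dist_adj hG).
apply: (step x y) => //; apply: squareI => //.
- by apply/adj_sym/(dist_adj hG).
- by apply/adj_sym/(dist_adj hG).
- exact: adj_sym.
- by move=> h; rewrite h in Ax.
Qed.

Lemma nearer_compl x y : adj x y -> ~` nearer x y = nearer y x.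
Proof.
move=> xy; apply/seteqP; split=> z; rewrite /nearer /=; last by lia.
by have [] := adj_parity z xy; lia.
Qed.

Lemma nearer_halfspace x y : adj x y -> halfspace (nearer x y).
Proof.
move=> xy; split; first exact: nearer_convex.
by rewrite nearer_compl //; apply/nearer_convex/adj_sym.
Qed.

Lemma nearer_self x y : adj x y -> nearer x y x /\ ~ nearer x y y.
Proof.
move=> xy; rewrite /nearer /= !distxx (dist_sym hG y) (adj_dist hG xy).
by split.
Qed.

End Median.

(** * Contracting the edges of one colour *)


Section Integration.
Variables (G : sgraph) (mG : median_graph G) (V : Type) (o : G) (v0 : V).
Variable step : G -> G -> V -> V.

Let hG : connected G := mG.1.

(* Consistency around squares suffices because |G| is simply connected; here the
   quadrangle condition replaces any homotopy argument. *)
Lemma integrate :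
  (forall x y z w, square y x z w -> dist o x = (dist o y).+1 ->
    dist o y = (dist o w).+1 -> forall v,
    step y x (step w y v) = step z x (step w z v)) ->
  exists s : G -> V, s o = v0 /\
    forall x y, adj y x -> dist o x = (dist o y).+1 -> s x = step y x (s y).
Proof.
move=> hsq.
(* [p x] is a chosen neighbour of [x] one step nearer to [o], and [s] is computed along chosen
   parents. It remains to see that any other parent [y] gives the same value: by the quadrangle
   condition [y] and [p x] have a common parent. *)
have /choice[p hp] x : exists y, forall n, dist o x = n.+1 ->
    adj y x /\ dist o y = n.
  case e: (dist o x) => [|n]; first by exists x.
  rewrite (dist_sym hG) in e; have [y xy ey] := dist_step hG e.
  by exists y => _ [<-]; split; [exact: adj_sym|rewrite (dist_sym hG)].
pose s := fix s (n : nat) (x : G) {struct n} :=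
  if n is n'.+1 then step (p x) x (s n' (p x)) else v0.
have sS n x : s n.+1 x = step (p x) x (s n (p x)) by [].
exists (fun x => s (dist o x) x); split; first by rewrite distxx.
move=> x y yx; move e: (dist o y) => n; elim: n x y yx e => [|n IHn] x y yx ey ex;
  rewrite ex sS; have [px dp] := hp _ _ ex.
  by rewrite -(dist_eq0 hG ey) -(dist_eq0 hG dp).
case: (pselect (y = p x)) => [<- //|nyp].
have [w [sq yw pw]] := quadrangle mG yx (adj_sym px) nyp
  (etrans ex (congr1 S (esym ey))) (etrans ex (congr1 S (esym dp))).
case: (sq) => [[_ _ /adj_sym wp wy] _].
have ew : dist o w = n by lia.
have := IHn _ _ wy ew ey; have := IHn _ _ wp ew dp.
rewrite ey dp => -> ->; symmetry; apply: (hsq _ _ _ _ sq); lia.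
Qed.

End Integration.

(** A cycle that leaves [W] along [a b] can come back only along the same edge, so its vertices
    after the first stay outside [W] and the closing edge is [a b] again. This would be a cycle of
    length two. *)
Lemma acyclic_bridges (T : sgraph) :
  (forall a b : T, adj a b -> exists W : set T, [/\ W a, ~ W b
    & forall u v, adj u v -> W u -> ~ W v -> u = a /\ v = b]) ->
  acyclic T.
Proof.
move=> hb [|n] c n2 cI cadj //.
have ordSE (i : 'I_n.+1) : i < n -> ordS i = i.+1 :> nat.
  by move=> h; rewrite /= modn_small.
have [W [Wa Wb hW]] := hb _ _ (cadj ord0).
have aux k : 0 < k -> forall i : 'I_n.+1, i = k :> nat -> ~ W (c i).
  elim: k => // k IHk _ i ik; have kn : k < n by have := ltn_ord i; lia.
  have eSk : ordS (inord k : 'I_n.+1) = i.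
    by apply: val_inj; rewrite /= inordK ?modn_small ?ik //; lia.
  case: k => [|k] in IHk kn eSk ik *.
    suff -> : i = ordS ord0 by [].
    by rewrite -eSk; congr ordS; apply: val_inj; rewrite /= inordK.
  move=> Wi; have := hW _ _ (adj_sym (cadj (inord k.+1))).
  rewrite eSk => /(_ Wi) [|/cI e _].
    by apply: IHk => //; rewrite inordK //; lia.
  by move: ik; rewrite e.
have nmax : ~ W (c ord_max) by apply: (aux n) => //; lia.
have e : ordS (@ord_max n) = ord0 by apply: val_inj; rewrite /= modnn.
have := hW _ _ (adj_sym (cadj ord_max)); rewrite e => /(_ Wa nmax) [_ /cI h].
by have := ordSE ord0; rewrite -h /=; lia.
Qed.

Section Quotient.
Variables (G : sgraph) (mG : median_graph G).
Variables (c : G -> G -> bool) (hc : square_colouring c) (b : bool).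
Implicit Types x y z u v w : G.

Let hG : connected G := mG.1.

(** The component of [x] after removal of the edges of colour [b], as the intersection of all sets
    closed under the other edges. Contracting these components leaves a tree whose edges come from
    colour [b]. *)
Definition colour_class x : set G :=
  [set y | forall P : set G,
    (forall u v, adj u v -> c u v <> b -> P u -> P v) -> P x -> P y].

Lemma class_refl x : colour_class x x.
Proof. by move=> P. Qed.

Lemma class_trans x y z :
  colour_class x y -> colour_class y z -> colour_class x z.
Proof. by move=> xy yz P hP /(xy P hP) /(yz P hP). Qed.

Lemma class_sym x y : colour_class x y -> colour_class y x.
Proof.
move=> xy P hP; apply: (xy (fun z => P z -> P x)) => // u v uv cuv h /(hP v u).
by move=> Pu; apply/h/Pu; [exact: adj_sym|rewrite hc.1].
Qed.

Lemma class_adj x y : adj x y -> c x y <> b -> colour_class x y.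
Proof. by move=> xy cxy P hP; apply: hP. Qed.

Lemma class_eq x y : colour_class x = colour_class y <-> colour_class x y.
Proof.
split=> [->|h]; first exact: class_refl.
by apply/seteqP; split=> z; apply: class_trans; [apply: class_sym|].
Qed.

Definition quotient_vertex := {A : set G | exists x, A = colour_class x}.

Definition to_quotient x : quotient_vertex :=
  exist _ (colour_class x) (ex_intro _ x erefl).

Let qadj (A B : quotient_vertex) := A <> B /\ exists x y,
  [/\ adj x y, c x y = b, A = to_quotient x & B = to_quotient y].

Fact qadj_sym A B : qadj A B -> qadj B A.
Proof.
case=> nAB [x [y [xy cxy eA eB]]]; split; first exact: nesym.
by exists y, x; split=> //; [exact: adj_sym|rewrite hc.1].
Qed.

Fact qadj_irrefl A : ~ qadj A A.
Proof. by case. Qed.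

Definition quotient_tree : sgraph := SGraph qadj_sym qadj_irrefl.

Definition quotient_map x : quotient_tree := to_quotient x.

Lemma quotient_map_eq x y :
  quotient_map x = quotient_map y <-> colour_class x y.
Proof.
rewrite -class_eq; split=> [[]//|h]; exact: eq_exist.
Qed.

Lemma quotient_map_onto (t : quotient_tree) : exists x, quotient_map x = t.
Proof. by case: t => A [x eA]; exists x; apply: eq_exist. Qed.

(** On the ladder from [x y] to [u v] the rungs are opposite edges of squares, so they all have
    colour [b]; the rails have the other colour, so each of them stays within one class. *)
Lemma crossing_colour x y u v : adj x y -> c x y = b -> adj u v ->
  nearer x y u -> ~ nearer x y v ->
  [/\ c u v = b, colour_class x u & colour_class y v].
Proof.
move=> xy cxy uv nu nv; have [nx ny] := nearer_self mG xy.
pose P u v := [/\ c u v = b, colour_class x u & colour_class y v].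
apply: (ladder mG (P := P) (nearer_halfspace mG xy) _ xy nx ny uv nu nv); last first.
  by split; [|exact: class_refl|exact: class_refl].
move=> p q p' q' sq _ _ _ _ [cpq xp yq].
have n1 := hc.2 _ _ _ _ sq.
have n2 := hc.2 _ _ _ _ (square_rot (square_rot (square_rot sq))).
have e := square_opposite hc sq.
case: sq => [[_ qq' _ p'p] _]; split; first by rewrite -e.
- apply: (class_trans xp); apply: class_sym; apply: class_adj => //.
  by rewrite -cpq.
- by apply: (class_trans yq); apply: class_adj; rewrite // -cpq; apply: nesym.
Qed.

Lemma edge_separates x y : adj x y -> c x y = b -> ~ colour_class x y.
Proof.
move=> xy cxy /(_ (nearer x y)) h; have [nx ny] := nearer_self mG xy.
apply/ny/h => // u v uv cuv nu; apply: contrapT => nv; apply: cuv.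
by have [] := crossing_colour xy cxy uv nu nv.
Qed.

Lemma quotient_map_adj x y : adj x y ->
  if c x y == b then adj (quotient_map x) (quotient_map y)
  else quotient_map x = quotient_map y.
Proof.
move=> xy; case: eqP => cxy.
  split; last by exists x, y.
  by move=> /quotient_map_eq /(edge_separates xy cxy).
by apply/quotient_map_eq; apply: class_adj.
Qed.

Lemma quotient_connected : connected quotient_tree.
Proof.
have /connectedP[[x0 _] hP] := hG; apply/connectedP; split.
  by exists (quotient_map x0).
move=> P adjP s t.
have [x <-] := quotient_map_onto s; have [y <-] := quotient_map_onto t.
apply: (hP (fun x => P (quotient_map x))) => u v uv.
by have := quotient_map_adj uv; case: eqP => [_ /adjP//|_ ->].
Qed.

Lemma quotient_acyclic : acyclic quotient_tree.
Proof.
apply: acyclic_bridges => A B [_ [x [y [xy cxy -> ->]]]].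
have [nx ny] := nearer_self mG xy.
(* The halfspace is a union of classes, so its image is one side of the quotient edge; by
   [crossing_colour] no other quotient edge leaves that side. *)
have stable u v : colour_class u v -> nearer x y u -> nearer x y v.
  move=> h; apply: (h (nearer x y)) => p q pq cpq np.
  apply: contrapT => nq; apply: cpq.
  by have [] := crossing_colour xy cxy pq np nq.
exists [set t | exists2 u, quotient_map u = t & nearer x y u]; split.
- by exists x.
- by case=> u /quotient_map_eq/stable h /h.
move=> s t [_ [u [v [uv cuv -> ->]]]] [u' /quotient_map_eq/stable h /h nu] nv.
have nv' : ~ nearer x y v by move=> h'; apply: nv; exists v.
have [_ xu yv] := crossing_colour xy cxy uv nu nv'.
by split; apply/quotient_map_eq; apply: class_sym.
Qed.

Lemma quotient_is_tree : tree quotient_tree.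
Proof. exact: (conj quotient_connected quotient_acyclic). Qed.

(* Counts the edges of colour b on a geodesic from o. *)
Definition is_level (o : G) (h : G -> nat) : Prop := h o = 0 /\
  forall x y, adj y x -> dist o x = (dist o y).+1 ->
    h x = h y + (c y x == b).

Lemma level_ex o : exists h, is_level o h.
Proof.
apply: (integrate mG 0 (step := fun y x n => n + (c y x == b))) => x y z w sq _ _ n.
have e1 := square_opposite hc sq.
have e2 := square_opposite hc (square_rot sq).
by rewrite e1 (hc.1 z x) e2 (hc.1 w y); lia.
Qed.

(** The level changes by at most one along an edge, and only if the edge has colour [b]; it is
    therefore constant on classes and 1-Lipschitz on the quotient. This is the lower bound for
    distances in the tree. *)
Lemma level_dist o h : is_level o h ->
  forall x, h x <= dist (quotient_map o) (quotient_map x).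
Proof.
move=> [h0 hS] x.
have hadj u v : adj u v -> h v <= h u + (c u v == b).
  move=> uv; case: (adj_parity mG o uv) => e; last by rewrite (hS v u).
  by rewrite (hS u v) //; [lia|exact: adj_sym].
have inv u v : colour_class u v -> h v <= h u.
  move=> uv; apply: (uv (fun v => h v <= h u)) => // p q pq cpq.
  by have := hadj _ _ pq; case: eqP => // _; lia.
suff aux n u v : walk n (quotient_map u) (quotient_map v) -> h v <= h u + n.
  by have := aux _ _ _ (dist_walk quotient_connected (quotient_map o) (quotient_map x)); rewrite h0.
elim: n u => [|n IHn] u /=; first by move/quotient_map_eq/inv; lia.
case=> t [_ [p [q [pq cpq /quotient_map_eq up ->]]]] /IHn.
have := inv _ _ up; have := hadj _ _ pq; lia.
Qed.

End Quotient.

(** * Products of trees *)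


Lemma walk_map (G H : sgraph) (f : G -> H) :
  (forall x y, adj x y -> adj (f x) (f y)) ->
  forall n x y, walk n x y -> walk n (f x) (f y).
Proof.
move=> hf; elim=> [|n IHn] x y /=; first by move=> ->.
by case=> z xz zy; exists (f z); [exact: hf|exact: IHn].
Qed.

Section CartesianMetric.
Variables (T1 T2 : sgraph) (h1 : connected T1) (h2 : connected T2).
Implicit Types p q m : cartesian T1 T2.

Lemma cartesian_walk p q : walk (dist p.1 q.1 + dist p.2 q.2) p q.
Proof.
case: p q => [a b] [a' b'] /=; apply: (@walk_cat (cartesian T1 T2) _ _ _ (a', b)).
  apply: (walk_map (f := fun t => (t, b) : cartesian T1 T2)) (dist_walk h1 _ _).
  by move=> x y xy; right.
apply: (walk_map (f := fun t => (a', t) : cartesian T1 T2)) (dist_walk h2 _ _).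
by move=> x y xy; left.
Qed.

Lemma cartesian_connected : connected (cartesian T1 T2).
Proof.
have [[[a _] _] [[b _] _]] := (h1, h2); split; first by exists (a, b).
by move=> p q; eexists; apply: cartesian_walk.
Qed.

Lemma cartesian_dist p q : dist p q = dist p.1 q.1 + dist p.2 q.2.
Proof.
apply/eqP; rewrite eqn_leq dist_le ?andTb; last exact: cartesian_walk.
have := dist_walk cartesian_connected p q; move: (dist p q) => n.
elim: n p => [|n IHn] p /=; first by move=> ->; rewrite !distxx.
case=> r [[-> pr]|[pr ->]] /IHn.
  by have := dist_tri h2 r.2 p.2 q.2; rewrite (adj_dist h2 pr); lia.
by have := dist_tri h1 r.1 p.1 q.1; rewrite (adj_dist h1 pr); lia.
Qed.

Lemma cartesian_interval p q m :
  interval p q m <-> interval p.1 q.1 m.1 /\ interval p.2 q.2 m.2.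
Proof.
rewrite /interval /= !cartesian_dist.
have := dist_tri h1 m.1 p.1 q.1; have := dist_tri h2 m.2 p.2 q.2.
by split=> [|[]]; lia.
Qed.

End CartesianMetric.

Lemma interval_point (G : sgraph) (hG : connected G) (x y : G) k :
  k <= dist x y -> exists p, interval x y p /\ dist x p = k.
Proof.
elim: k x => [|k IHk] x hk; first by exists x; rewrite /interval /= distxx.
case e: (dist x y) => [|n]; first by lia.
have [z xz ez] := dist_step hG e.
have [|p [ip ep]] := IHk z; first by lia.
have iz : interval x y z by rewrite /interval /= e ez (adj_dist hG xz).
have [ipx izp] := interval_transr hG iz ip; exists p; split=> //.
by move: izp; rewrite /interval /= ep (adj_dist hG xz).
Qed.

Section Trees.
Variables (T : sgraph) (hT : tree T).
Implicit Types a b x y z m s t : T.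

Let cT : connected T := hT.1.

Section EdgeDeletion.
Variables a b : T.

Let dadj x y := [/\ adj x y, ~ (x = a /\ y = b) & ~ (x = b /\ y = a)].

Fact deleted_sym x y : dadj x y -> dadj y x.
Proof. by case=> xy h1 h2; split; [exact: adj_sym|case=> *; apply: h2|case=> *; apply: h1]. Qed.

Fact deleted_irrefl x : ~ dadj x x.
Proof. by case=> /adj_irrefl. Qed.

Definition delete_edge : sgraph := SGraph deleted_sym deleted_irrefl.

End EdgeDeletion.

Lemma tree_bridge a b : adj a b -> exists W : set T, [/\ W a, ~ W b
  & forall u v, adj u v -> W u -> ~ W v -> u = a /\ v = b].
Proof.
move=> ab; pose D := delete_edge a b.
(* [W] is the component of [a] once the edge [a b] is deleted. If it contained [b], a shortest path
   there, closed up by the edge, would be a cycle. *)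
exists [set z | exists n, @walk D n a z]; split; first by exists 0.
  case=> n /walk_dist[+ _]; set k := dist _ _ => wk.
  have [p [p0 pk pS]] := walk_path wk.
  have pmin i j : i < j <= k -> p i <> p j.
    move=> ijk e; have w1 : @walk D i a (p i).
      by rewrite -p0; apply: (@path_walk D p 0 i) => l hl; apply: pS; lia.
    have w2 : @walk D (k - j) (p j) b.
      have -> : b = p (j + (k - j)) by rewrite subnKC //; lia.
      by apply: (@path_walk D p j) => l hl; apply: pS; lia.
    by rewrite -e in w2; have := dist_le (walk_cat w1 w2); rewrite -/k; lia.
  apply: (hT.2 k.+1 (fun i : 'I_k.+1 => p i)).
  (* The cycle has [k.+1] vertices: [k = 0] would mean [a = b], and [k = 1] would use the deleted
     edge. *)
  - case ek : k => [|[|//]]; rewrite ek in pk pS.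
      by have := adj_neq ab; rewrite -p0 -pk.
    by have [_ []] := pS 0 isT; rewrite p0 pk.
  - move=> i j /= e; apply: val_inj => /=.
    have hi := ltn_ord i; have hj := ltn_ord j.
    have [h|h|//] := ltngtP i j; first by case: (pmin i j _ e); lia.
    by case: (pmin j i _ (esym e)); lia.
  move=> i; have hi := ltn_ord i; rewrite /=.
  have [h|h] : i < k \/ i = k :> nat by lia.
    by rewrite modn_small //; have [] := pS i h.
  by rewrite h modnn p0 pk; apply: adj_sym.
move=> u v uv [n wu] nv; case: (pselect (@adj D u v)) => h.
  by case: nv; exists (n + 1); apply: walk_cat wu _; exists v.
have [//|h'] : (u = a /\ v = b) \/ (u = b /\ v = a).
  by apply: contrapT => /not_orP[h1 h2]; apply: h; split.
by case: nv; exists 0; case: h' => _ ->.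
Qed.

Lemma tree_split a b : adj a b -> exists W : set T, [/\ W a, ~ W b,
  forall u v, adj u v -> W u -> ~ W v -> u = a /\ v = b
  & forall x y, W x -> ~ W y -> dist x y = dist x a + (dist b y).+1].
Proof.
move=> ab; have [W [Wa Wb hW]] := tree_bridge ab; exists W; split=> // x y Wx Wy.
apply/eqP; rewrite eqn_leq; apply/andP; split.
  have := dist_tri cT a x y; have := dist_tri cT b a y.
  by rewrite (adj_dist cT ab); lia.
have := dist_walk cT x y; move: (dist x y) => n.
elim: n x Wx => [|n IHn] x Wx /=; first by move=> e; rewrite e in Wx.
case=> z xz zy; case: (pselect (W z)) => Wz.
  have := IHn z Wz zy; have := dist_tri cT z x a.
  by rewrite (adj_dist cT xz); lia.
have [-> e] := hW _ _ xz Wx Wz; rewrite e in zy.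
by rewrite distxx; have := dist_le zy; lia.
Qed.

Lemma tree_parity z a b : adj a b ->
  dist z a = (dist z b).+1 \/ dist z b = (dist z a).+1.
Proof.
move=> ab; have [W [Wa Wb _ hW]] := tree_split ab.
case: (pselect (W z)) => Wz; [right|left].
  by rewrite (hW z b) // distxx; lia.
by rewrite dist_sym // (hW a z) // distxx (dist_sym cT b).
Qed.

(** The edge [a b] separates [a] from [z]. A second neighbour [b'] would lie on the side of [a], and
    the way from it to [z] would lead back through [a]. *)
Lemma tree_parent_uniq z a b b' : adj a b -> adj a b' ->
  dist z a = (dist z b).+1 -> dist z a = (dist z b').+1 -> b = b'.
Proof.
move=> ab ab' e e'; have [W [Wa Wb hc hW]] := tree_split ab.
have Wz : ~ W z by move=> Wz; have := hW z b Wz Wb; rewrite distxx; lia.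
apply: contrapT => nbb; have Wb' : W b'.
  by apply: contrapT => /(hc _ _ ab' Wa)[_ h]; apply: nbb.
have := hW _ _ Wb' Wz; rewrite (adj_dist cT (adj_sym ab')).
by rewrite (dist_sym cT b') (dist_sym cT b); lia.
Qed.

Lemma tree_interval_uniq x y m m' : interval x y m -> interval x y m' ->
  dist x m = dist x m' -> m = m'.
Proof.
move e: (dist x m) => n; elim: n x e => [|n IHn] x e im im' e'.
  by rewrite -(dist_eq0 cT e) -(dist_eq0 cT (esym e')).
have [z xz ez] := dist_step cT e; have [z' xz' ez'] := dist_step cT (esym e').
move: im im'; rewrite /interval /= => im im'.
have t1 := dist_tri cT m z y; have t2 := dist_tri cT z x y.
have t3 := dist_tri cT m' z' y; have t4 := dist_tri cT z' x y.
rewrite (adj_dist cT xz) in t2; rewrite (adj_dist cT xz') in t4.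
have zz' : z = z'.
  by apply: (tree_parent_uniq (z := y) xz xz'); rewrite !(dist_sym cT y); lia.
by subst z'; apply: (IHn z) => //; rewrite /interval /=; lia.
Qed.

(** Move [y] one step towards [x]. If this also approaches [z], the median for the new vertex
    serves; otherwise the edge just traversed separates [x] from [z], and [y] itself is the
    median. *)
Lemma tree_median_ex x y z :
  exists m, [/\ interval x y m, interval y z m & interval x z m].
Proof.
move e: (dist x y) => n; elim: n y e => [|n IHn] y e.
  by rewrite -(dist_eq0 cT e); exists x; rewrite /interval /= !distxx.
rewrite dist_sym // in e; have [y' yy' ey'] := dist_step cT e.
rewrite dist_sym // in ey'; have [m [m1 m2 m3]] := IHn _ ey'.
have y1 := adj_dist cT yy'; have y2 := adj_dist cT (adj_sym yy').
rewrite dist_sym // in e.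
have [h|h] := tree_parity z yy'.
  have i1 : interval x y y' by rewrite /interval /=; lia.
  have i2 : interval z y y' by rewrite /interval /=; lia.
  rewrite interval_sym // in m2; exists m; split=> //.
    by have [] := interval_trans cT i1 m1.
  by rewrite interval_sym //; have [] := interval_trans cT i2 m2.
have [W [Wy' Wy _ hW]] := tree_split (adj_sym yy').
have Wx : W x.
  by apply: contrapT => Wx; have := hW _ _ Wy' Wx;
    rewrite distxx !(dist_sym cT _ x); lia.
have Wz : ~ W z by move=> Wz; have := hW _ _ Wz Wy; rewrite distxx; lia.
have := hW _ _ Wx Wz => exz.
by exists y; rewrite /interval /= !distxx; split; lia.
Qed.

Lemma tree_interval_split x y m s : interval x y m -> interval x y s ->
  interval x m s \/ interval m y s.
Proof.
have aux a b p q : interval a b p -> interval a b q ->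
    dist a q <= dist a p -> interval a p q.
  move=> ip iq le; have [r [ir er]] := interval_point cT le.
  have [ir' _] := interval_trans cT ip ir.
  by rewrite -(tree_interval_uniq ir' iq er).
move=> im is_; case: (leqP (dist x s) (dist x m)) => h; first by left; apply: (aux x y).
right; rewrite (interval_sym cT); apply: (aux y x).
- by rewrite (interval_sym cT).
- by rewrite (interval_sym cT).
move: im is_; rewrite /interval /= (dist_sym cT y s) (dist_sym cT y m); lia.
Qed.

(** The intervals form a tripod with centre [m], and each of [p], [q], [r] lies on a leg. If [p] is
    on the leg of [x], then [q] is on another leg; if [p] is on the leg of [y], then [r] is. *)
Lemma tree_median_between x y z m p q r :
  interval x y m -> interval y z m -> interval x z m ->
  interval x y p -> interval y z q -> interval x z r ->
  interval p q m \/ interval p r m.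
Proof.
have aux a b t u : interval a b m -> interval a m t -> interval m b u ->
    interval t u m.
  rewrite /interval /=; have := dist_tri cT m t u; have := dist_tri cT t a b.
  by have := dist_tri cT u t b; lia.
have S := interval_sym cT.
move=> mxy myz mxz pxy qyz rxz.
have [h|h] := tree_interval_split mxy pxy.
  left; have [h'|h'] := tree_interval_split myz qyz.
    by apply: (aux x y) => //; rewrite S.
  exact: (aux x z).
right; have [h'|h'] := tree_interval_split mxz rxz.
  by apply: (aux y x); rewrite S.
by apply: (aux y z) => //; rewrite S.
Qed.

End Trees.

(** * Embeddings and edge colourings *)


Definition edge_colour (G T1 T2 : sgraph) (f : G -> cartesian T1 T2)
  (x y : G) : bool := `[< (f x).1 <> (f y).1 >].

Lemma coordinatization (G : sgraph) (c : G -> G -> bool) :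
  median_graph G -> square_colouring c ->
  exists (T1 T2 : sgraph) (f : G -> cartesian T1 T2),
    [/\ tree T1, tree T2, minimal_embedding f
      & forall x y, adj x y -> edge_colour f x y = c x y].
Proof.
move=> mG hc; have hG := mG.1.
pose T b := quotient_tree hc b.
pose f x : cartesian (T true) (T false) :=
  (quotient_map hc true x, quotient_map hc false x).
have hT b : tree (T b) := quotient_is_tree mG hc b.
exists (T true), (T false), f; split=> //; last first.
  move=> x y xy; have := quotient_map_adj mG hc true xy; rewrite /edge_colour.
  case: (c x y) => /= h; first by apply/asboolP; case: h.
  by apply: asboolF => /(_ h).
split; first last.
- by move=> t; have [x] := quotient_map_onto t; exists x.
- by move=> t; have [x] := quotient_map_onto t; exists x.
have fadj x y : adj x y -> adj (f x) (f y).
  move=> xy; have := quotient_map_adj mG hc true xy.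
  have := quotient_map_adj mG hc false xy.
  by case: (c x y) => /= h1 h2; [right|left].
move=> x y; apply/eqP; rewrite eqn_leq; apply/andP; split.
  by apply: dist_le; apply: walk_map fadj _ _ _ _; apply: dist_walk.
(* Each edge of a geodesic from [x] counts in exactly one of the two levels, so these add up to the
   distance, while each is at most a tree distance. *)
have [h1 lev1] := level_ex mG hc true x; have [h2 lev2] := level_ex mG hc false x.
rewrite (cartesian_dist (hT _).1 (hT _).1) /=.
have := level_dist mG hc lev1 y; have := level_dist mG hc lev2 y.
suff : h1 y + h2 y = dist x y by rewrite /f /T /=; lia.
move e: (dist x y) => n; elim: n y e => [|n IHn] y e.
  by rewrite -(dist_eq0 hG e) lev1.1 lev2.1.
rewrite (dist_sym hG) in e; have [z yz ez] := dist_step hG e.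
rewrite !(dist_sym hG _ x) in e ez.
rewrite (lev1.2 y z) ?(lev2.2 y z) ?e ?ez //; try exact: adj_sym.
by rewrite -(IHn z ez); case: (c z y); lia.
Qed.

(** What the two coordinate maps of an embedding have in common, so that each argument about one
    factor also serves the other. *)
Definition coordinate (G T : sgraph) (g : G -> T) : Prop :=
  (forall x y z, interval x y z -> interval (g x) (g y) (g z)) /\
  forall x y, adj x y -> dist (g x) (g y) <= 1.

Section Coordinate.
Variables (G T : sgraph) (hG : connected G) (hT : connected T).
Variables (g : G -> T) (hg : coordinate g).

Lemma coordinate_adj x y : adj x y -> g x = g y \/ adj (g x) (g y).
Proof.
move=> /hg.2; case e: (dist _ _) => [|[|//]] _; first by left; apply: dist_eq0 e.
by right; apply: dist_adj.
Qed.

(** As betweenness is preserved, the distance of the images is the number of edges on a geodesic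
    that [g] does not collapse. *)
Lemma coordinate_dist (T' : sgraph) (hT' : connected T') (g' : G -> T') :
  coordinate g' -> (forall x y, adj x y -> g x = g y <-> g' x = g' y) ->
  forall x y, dist (g x) (g y) = dist (g' x) (g' y).
Proof.
move=> hg' e x y; move ed: (dist x y) => n; elim: n x ed => [|n IHn] x ed.
  by rewrite (dist_eq0 hG ed) !distxx.
have [z xz ez] := dist_step hG ed.
have i : interval x y z by rewrite /interval /= ed ez (adj_dist hG xz).
have := hg.1 _ _ _ i; have := hg'.1 _ _ _ i; rewrite /interval /= => -> ->.
rewrite IHn //; congr addn; have h := e _ _ xz.
have := hg.2 _ _ xz; have := hg'.2 _ _ xz.
case e1: (dist (g x) _) => [|[|//]]; case e2: (dist (g' x) _) => [|[|//]] // _ _.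
  by have := h.1 (dist_eq0 hT e1) => e3; rewrite e3 distxx in e2.
by have := h.2 (dist_eq0 hT' e2) => e3; rewrite e3 distxx in e1.
Qed.

End Coordinate.

(** Along a geodesic from [x] to [y] the image either rests or moves to the unique neighbour towards
    [g y], so it cannot skip [t]. *)
Lemma coordinate_fibre (G T : sgraph) (hG : connected G) (hT : tree T)
    (g : G -> T) : coordinate g -> forall x y t,
  interval (g x) (g y) t -> exists p, interval x y p /\ g p = t.
Proof.
move=> hg x y t; have cT := hT.1.
move ed: (dist x y) => n; elim: n x ed => [|n IHn] x ed it.
  rewrite (dist_eq0 hG ed) in it *; exists y; move: it.
  rewrite /interval /= !distxx; split=> //.
  by apply/esym/(dist_eq0 cT); lia.
case e0: (dist (g x) t) => [|k].
  by exists x; rewrite /interval /= distxx; split=> //; apply: (dist_eq0 cT).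
have [z xz ez] := dist_step hG ed.
have i : interval x y z by rewrite /interval /= ed ez (adj_dist hG xz).
have ig := hg.1 _ _ _ i.
suff /(IHn z ez)[p [ip ep]] : interval (g z) (g y) t.
  by exists p; split=> //; have [] := interval_transr hG i ip.
have [e|gxz] := coordinate_adj cT hg xz; first by rewrite -e.
have [s xs es] := dist_step cT e0.
move: it ig; rewrite /interval /= (adj_dist cT gxz) => it ig.
have t1 := dist_tri cT t s (g y).
have t2 := dist_tri cT s (g x) (g y); rewrite (adj_dist cT xs) in t2.
have -> : g z = s; last by lia.
by apply: (tree_parent_uniq hT (z := g y) gxz xs); rewrite !(dist_sym cT (g y)); lia.
Qed.

Section Embedding.
Variables (G T1 T2 : sgraph) (hG : connected G) (h1 : tree T1) (h2 : tree T2).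
Variables (f : G -> cartesian T1 T2) (hf : isometric_embedding f).

Let c1 : connected T1 := h1.1.
Let c2 : connected T2 := h2.1.

Lemma embedding_interval x y z : interval x y z <->
  interval (f x).1 (f y).1 (f z).1 /\ interval (f x).2 (f y).2 (f z).2.
Proof. by rewrite -(cartesian_interval c1 c2) /interval /= !hf. Qed.

Lemma embedding_adj x y : adj x y -> adj (f x) (f y).
Proof.
move=> xy; apply: (dist_adj (cartesian_connected c1 c2)).
by rewrite hf (adj_dist hG).
Qed.

Lemma coordinate_fst : coordinate (fun x => (f x).1).
Proof.
split=> [x y z /embedding_interval[]//|x y /(adj_dist hG)].
by rewrite -hf (cartesian_dist c1 c2); lia.
Qed.

Lemma coordinate_snd : coordinate (fun x => (f x).2).
Proof.
split=> [x y z /embedding_interval[]//|x y /(adj_dist hG)].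
by rewrite -hf (cartesian_dist c1 c2); lia.
Qed.

Lemma embedding_edge x y : adj x y -> (f x).1 = (f y).1 <-> (f x).2 <> (f y).2.
Proof.
move=> /embedding_adj[[e h]|[h e]]; split=> //.
- by move=> _; apply: adj_neq h.
- by move=> e'; have := adj_neq h e'.
Qed.

Lemma embedding_inj x y : f x = f y -> x = y.
Proof. by move=> e; apply: (dist_eq0 hG); rewrite -hf e distxx. Qed.

(* If m1 is the median of the first coordinates, then every geodesic of G between
   two of the points meets the fibre over m1; among the three points obtained
   there are two whose second coordinates have m2 between them. *)
Lemma embedding_median_closed x y z m :
  interval (f x) (f y) m -> interval (f y) (f z) m -> interval (f x) (f z) m ->
  exists n, f n = m.
Proof.
move=> /(cartesian_interval c1 c2)[m1 m2] /(cartesian_interval c1 c2)[m3 m4].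
move=> /(cartesian_interval c1 c2)[m5 m6].
have [p [/embedding_interval[_ p2] ep]] := coordinate_fibre hG h1 coordinate_fst m1.
have [q [/embedding_interval[_ q2] eq]] := coordinate_fibre hG h1 coordinate_fst m3.
have [r [/embedding_interval[_ r2] er]] := coordinate_fibre hG h1 coordinate_fst m5.
(* Everything between [a] and [b] has first coordinate [m.1], so it is enough to hit [m.2] with the
   second coordinate. *)
have aux a b : (f a).1 = m.1 -> (f b).1 = m.1 -> interval (f a).2 (f b).2 m.2 ->
    exists n, f n = m.
  move=> ea eb /(coordinate_fibre hG h2 coordinate_snd)[n []].
  move=> /embedding_interval[h _] e2; exists n; move: h.
  rewrite ea eb /interval /= distxx => h.
  have e1 : m.1 = (f n).1 by apply: (dist_eq0 c1); lia.
  by rewrite [LHS]surjective_pairing -e1 e2 -surjective_pairing.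
by have [/aux|/aux] := tree_median_between h2 m2 m4 m6 p2 q2 r2; apply.
Qed.

Lemma embedding_median_subgraph : median_subgraph G (cartesian T1 T2).
Proof.
exists f; split=> // x y z [x' _ <-] [y' _ <-] [z' _ <-] m [[mxy myz] mzx].
rewrite (interval_sym (cartesian_connected c1 c2)) in mzx.
by have [n <-] := embedding_median_closed mxy myz mzx; exists n.
Qed.

Lemma embedding_median_graph : median_graph G.
Proof.
split=> // x y z.
have [m1 [m1a m1b m1c]] := tree_median_ex h1 (f x).1 (f y).1 (f z).1.
have [m2 [m2a m2b m2c]] := tree_median_ex h2 (f x).2 (f y).2 (f z).2.
have [||| n en] := @embedding_median_closed x y z (m1, m2).
1-3: exact/(cartesian_interval c1 c2).
exists n; split.
  have S := interval_sym hG z x.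
  by split; [split|rewrite S]; apply/embedding_interval; rewrite en.
have uniq (T : sgraph) (hT : tree T) (a b c m m' : T) :
    interval a b m -> interval b c m -> interval a c m ->
    interval a b m' -> interval b c m' -> interval c a m' -> m = m'.
  move=> ab bc ac ab' bc' ca'; apply: (tree_interval_uniq hT ab ab').
  have S := dist_sym hT.1; have := S c a; have := S b m; have := S b m'.
  have := S c m'; have := S m' a; move: ab bc ac ab' bc' ca'.
  by rewrite /interval /=; lia.
move=> m [[/embedding_interval[? ?] /embedding_interval[? ?]]].
move=> /embedding_interval[? ?]; apply: embedding_inj; rewrite en.
rewrite [f m]surjective_pairing.
congr (_, _).
  by apply: (uniq _ h1 (f x).1 (f y).1 (f z).1).
by apply: (uniq _ h2 (f x).2 (f y).2 (f z).2).
Qed.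

(** If [x y] and [y z] had the same colour, one coordinate would be constant on [x], [y], [z], hence
    on [w], which lies between [x] and [z]. In the other tree both [y] and [w] would map to the
    midpoint of a path of length 2, forcing [y = w]. *)
Lemma embedding_square_colouring : square_colouring (edge_colour f).
Proof.
split=> [x y|x y z w].
  by rewrite /edge_colour; congr asbool; apply/propext; split; apply: nesym.
move=> [[xy yz zw wx] [nxz nyw axz ayw]].
have mG := embedding_median_graph.
have ixz : interval x z y.
  by rewrite /interval /= (adj_dist hG xy) (adj_dist hG yz) (dist2 mG xy yz).
have ixw : interval x z w.
  rewrite /interval /= (adj_dist hG (adj_sym wx)) (adj_dist hG (adj_sym zw)).
  by rewrite (dist2 mG xy yz).
have straight (T T' : sgraph) (hT : tree T) (hT' : tree T') (g : G -> T)
    (g' : G -> T') : coordinate g -> coordinate g' ->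
    (forall a b, g a = g b -> g' a = g' b -> a = b) ->
    g' x = g' y -> g' y = g' z -> False.
  move=> hg hg' inj exy eyz.
  have exw : g' x = g' w.
    apply: (dist_eq0 hT'.1); have := hg'.1 _ _ _ ixw.
    by rewrite exy eyz /interval /= distxx; lia.
  have one a b : adj a b -> g' a = g' b -> dist (g a) (g b) = 1.
    move=> ab e; have := hg.2 _ _ ab; case e1: (dist _ _) => [|[|]] // _.
    by have := adj_neq ab (inj _ _ (dist_eq0 hT.1 e1) e).
  apply: nyw; apply: inj; last by rewrite -exy.
  apply: (tree_interval_uniq hT (hg.1 _ _ _ ixz) (hg.1 _ _ _ ixw)).
  by rewrite !one //; exact: adj_sym.
have inj a b : (f a).1 = (f b).1 -> (f a).2 = (f b).2 -> a = b.
  move=> e1 e2; apply: embedding_inj.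
  by rewrite [f a]surjective_pairing e1 e2 -surjective_pairing.
move=> h; have := straight _ _ h1 h2 _ _ coordinate_fst coordinate_snd inj.
have := straight _ _ h2 h1 _ _ coordinate_snd coordinate_fst
  (fun a b e1 e2 => inj a b e2 e1).
move: h; rewrite /edge_colour.
have [exy _] := embedding_edge xy; have [eyz _] := embedding_edge yz.
case: asboolP => nxy; case: asboolP => nyz // _ h3 h4.
  by apply: h4; apply: contrapT => h; [apply: nxy|apply: nyz]; apply/embedding_edge.
by apply: h3; apply: contrapT.
Qed.

End Embedding.

(** Both graphs are the quotient of [G] by the same pseudometric. *)
Lemma dist_isomorphism (G T T' : sgraph) (hT : connected T) (hT' : connected T')
    (g : G -> T) (g' : G -> T') :
  (forall t, exists x, g x = t) -> (forall t, exists x, g' x = t) ->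
  (forall x y, dist (g x) (g y) = dist (g' x) (g' y)) ->
  exists a : T -> T', isomorphism a /\ forall x, g' x = a (g x).
Proof.
move=> /choice[s hs] /choice[s' hs'] e.
have eg x y : g x = g y <-> g' x = g' y.
  by split=> h; apply: dist_eq0 => //; [rewrite -e|rewrite e]; rewrite h distxx.
exists (g' \o s); split; last by move=> x /=; apply/eg; rewrite hs.
split; first by exists (g \o s') => t /=; rewrite -[RHS](hs, hs'); apply/eg; rewrite ?hs ?hs'.
move=> x y /=; split=> /adj_dist h; apply: dist_adj => //.
  by rewrite -(hs x) -(hs y) e h.
by rewrite -e !hs h.
Qed.

Section Uniqueness.
Variables (G T1 T2 T1' T2' : sgraph) (hG : connected G).
Variables (h1 : tree T1) (h2 : tree T2) (h1' : tree T1') (h2' : tree T2').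
Variables (f : G -> cartesian T1 T2) (f' : G -> cartesian T1' T2').
Hypotheses (hf : minimal_embedding f) (hf' : minimal_embedding f').

Let fi : isometric_embedding f. Proof. by case: hf. Qed.
Let fi' : isometric_embedding f'. Proof. by case: hf'. Qed.

Lemma edge_colour_fst x y : edge_colour f x y = false <-> (f x).1 = (f y).1.
Proof.
rewrite /edge_colour; case: asboolP => h; split=> // _.
exact: contrapT.
Qed.

Lemma edge_colour_snd x y : adj x y ->
  edge_colour f x y = true <-> (f x).2 = (f y).2.
Proof.
move=> /(embedding_edge hG h1 h2 fi)[e1 e2]; rewrite /edge_colour.
case: asboolP => h; split=> //; last by move=> e; case: h => /e1.
by move=> _; apply: contrapT => /e2.
Qed.

Lemma equivalent_same_colour : equivalent_embeddings f f' ->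
  (forall x y, adj x y -> edge_colour f' x y = edge_colour f x y) \/
  (forall x y, adj x y -> edge_colour f' x y = ~~ edge_colour f x y).
Proof.
case=> -[a1 [a2 [[[b1 aK _] _] [[b2 bK _] _] e]]]; [left|right] => x y xy.
  rewrite /edge_colour; congr asbool; apply/propext.
  by rewrite (e x).1 (e y).1; split=> h h'; apply: h; [rewrite h'|apply: (can_inj aK)].
have [h3 h4] := edge_colour_snd xy.
rewrite {1}/edge_colour (e x).2 (e y).2.
case ec: (edge_colour f x y).
  by apply: asboolF; apply; rewrite h3.
by apply/asboolP => /(can_inj bK)/h4; rewrite ec.
Qed.

End Uniqueness.

Section Equivalence.
Variables (G T1 T2 T1' T2' : sgraph) (hG : connected G).
Variables (h1 : tree T1) (h2 : tree T2) (h1' : tree T1') (h2' : tree T2').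
Variables (f : G -> cartesian T1 T2) (f' : G -> cartesian T1' T2').
Hypotheses (hf : minimal_embedding f) (hf' : minimal_embedding f').

(** The colour tells which edges each coordinate collapses; by [coordinate_dist] this fixes the
    distances in each factor, and by surjectivity the factor itself. *)
Lemma same_colour_equivalent :
  (forall x y, adj x y -> edge_colour f' x y = edge_colour f x y) \/
  (forall x y, adj x y -> edge_colour f' x y = ~~ edge_colour f x y) ->
  equivalent_embeddings f f'.
Proof.
case: (hf) (hf') => fi o1 o2 [fi' o1' o2'].
have s1 := edge_colour_fst f; have s1' := edge_colour_fst f'.
have s2 := edge_colour_snd hG h1 h2 hf; have s2' := edge_colour_snd hG h1' h2' hf'.
have d1 := coordinate_fst hG h1 h2 fi; have d1' := coordinate_fst hG h1' h2' fi'.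
have d2 := coordinate_snd hG h1 h2 fi; have d2' := coordinate_snd hG h1' h2' fi'.
have iso (T T' : sgraph) (hT : tree T) (hT' : tree T') (g : G -> T)
    (g' : G -> T') : coordinate g -> coordinate g' ->
    (forall t, exists x, g x = t) -> (forall t, exists x, g' x = t) ->
    (forall x y, adj x y -> g x = g y <-> g' x = g' y) ->
    exists a : T -> T', isomorphism a /\ forall x, g' x = a (g x).
  move=> hg hg' o o' e; apply: (dist_isomorphism hT.1 hT'.1 o o').
  exact: (coordinate_dist hG hT.1 hg hT'.1).
case=> e; [left|right].
  have [|a1 [i1 j1]] := iso _ _ h1 h1' _ _ d1 d1' o1 o1'.
    by move=> x y /e exy; rewrite -s1 -s1' exy.
  have [|a2 [i2 j2]] := iso _ _ h2 h2' _ _ d2 d2' o2 o2'.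
    by move=> x y xy; rewrite -s2 // -s2' // e.
  by exists a1, a2; split.
have [|a1 [i1 j1]] := iso _ _ h1 h2' _ _ d1 d2' o1 o2'.
  by move=> x y xy; rewrite -s1 -s2' // e //; case: (edge_colour f x y).
have [|a2 [i2 j2]] := iso _ _ h2 h1' _ _ d2 d1' o2 o1'.
  by move=> x y xy; rewrite -s2 // -s1' e //; case: (edge_colour f x y).
by exists a1, a2; split.
Qed.

End Equivalence.

(** * Links *)


Lemma sval_inj (T : Type) (P : T -> Prop) : injective (@sval T P).
Proof. by move=> [x px] [y py] e; apply: eq_exist. Qed.

Section Cells.
Variable G : sgraph.
Implicit Types x y z w : G.

Lemma set2_injr x y z : [set x; y] = [set x; z] -> y = z.
Proof.
move=> e; have : [set x; z] y by rewrite -e; right.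
case=> //= yx; have : [set x; y] z by rewrite e; right.
by case=> /= ->; rewrite yx.
Qed.

Lemma set2_eq x y u v : [set x; y] = [set u; v] ->
  (x = u /\ y = v) \/ (x = v /\ y = u).
Proof.
move=> e; have : [set u; v] x by rewrite -e; left.
case=> /= xu; [left|right]; split=> //; rewrite xu in e.
  exact: set2_injr e.
by apply: (set2_injr (x := v)); rewrite e setUC.
Qed.

Lemma edge_at (e : set G) x : edge e -> e x -> exists2 y, adj x y & e = [set x; y].
Proof.
case=> a [b [ab ->]] [] /= ->; first by exists b.
by exists a; [exact: adj_sym|rewrite setUC].
Qed.

Lemma two_cell_square (C : set G) x : two_cell C -> C x ->
  exists a b c, C `<=` [set x; a; b; c] /\ square x a b c.
Proof.
case=> a [b [c [d [-> [nac nbd] [ab bc cd da] [ac bd]]]]].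
have sq : square a b c d by split.
case=> [[[]|]|] /= ->.
- by exists b, c, d; split=> // t.
- exists c, d, a; split; last exact: square_rot.
  by move=> t [[[]|]|] /= ->; [right|left; left; left|left; left; right|left; right].
- exists d, a, b; split; last exact/square_rot/square_rot.
  by move=> t [[[]|]|] /= ->; [left; right|right|left; left; left|left; left; right].
- exists a, b, c; split; last exact/square_rot/square_rot/square_rot.
  by move=> t [[[]|]|] /= ->; [left; left; right|left; right|right|left; left; left].
Qed.

Lemma common_cell_square (e f : set G) x :
  edge e -> edge f -> e <> f -> e x -> f x -> in_common_two_cell e f ->
  exists y z w, [/\ e = [set x; y], f = [set x; z] & square y x z w].
Proof.
move=> he hf nef ex fx [C [hC eC fC]].
have [y xy ey] := edge_at he ex; have [z xz ez] := edge_at hf fx.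
have [a [b [c [sub sq]]]] := two_cell_square hC (eC _ ex).
have [_ [_ _ nab _]] := sq.
have corner t : adj x t -> C t -> t = a \/ t = c.
  move=> xt /sub[[[]|]|] /= et; [|by left| |by right].
    by have := adj_neq xt; rewrite et.
  by rewrite et in xt.
have Cy : C y by apply: eC; rewrite ey; right.
have Cz : C z by apply: fC; rewrite ez; right.
have nyz : y <> z by move=> yz; apply: nef; rewrite ey ez yz.
have sq' : square c x a b by apply: square_rot; apply: square_rot; exact: square_rot.
exists y, z, b; split=> //.
have [yE|yE] := corner y xy Cy; have [zE|zE] := corner z xz Cz; subst => //.
exact: square_flip.
Qed.

Lemma square_common_cell x y z w : square y x z w ->
  [set x; y] <> [set x; z] /\ in_common_two_cell [set x; y] [set x; z].
Proof.
move=> [[yx xz zw wy] [nyz nxw ayz axw]]; split; first by move/set2_injr.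
exists [set y; x; z; w]; split; first by exists y, x, z, w.
- by move=> t [] /= ->; [left; left; right|left; left; left].
- by move=> t [] /= ->; [left; left; right|left; right].
Qed.

End Cells.

(** Connectedness of [Link x] expressed by neighbours of [x] instead of edge sets. It holds
    vacuously at an isolated vertex, whereas [connected] demands a vertex; hence the neighbour
    assumed in [link_connectedP]. *)
Definition link_connected (G : sgraph) (x : G) : Prop :=
  forall P : G -> Prop, (forall y z w, square y x z w -> P y -> P z) ->
  forall y z, adj x y -> adj x z -> P y -> P z.

Section Links.
Variable G : sgraph.
Implicit Types x y z w : G.

Definition link_vertex x y (xy : adj x y) : Link x :=
  exist _ [set x; y] (conj (ex_intro _ x (ex_intro _ y (conj xy erefl)))
                           (or_introl erefl)).

Lemma link_vertexP x (e : Link x) : exists y (xy : adj x y), e = link_vertex xy.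
Proof.
case: e => e [he ex]; have [y xy ey] := edge_at he ex.
by exists y, xy; apply: eq_exist.
Qed.

Lemma link_adj x (e f : Link x) : adj e f <-> exists y z w,
  [/\ sval e = [set x; y], sval f = [set x; z] & square y x z w].
Proof.
split=> [[nef hef]|[y [z [w [ee ef sq]]]]].
  exact: (common_cell_square (svalP e).1 (svalP f).1 nef (svalP e).2 (svalP f).2).
by rewrite /adj /= ee ef; apply: square_common_cell sq.
Qed.

Lemma link_connectedP x : (exists y, adj x y) ->
  connected (Link x) <-> link_connected x.
Proof.
move=> [y0 xy0]; split=> [/connectedP[_ h] P hP y z xy xz Py|h].
  have /h/(_ (link_vertex xy) (link_vertex xz)) : forall e f : Link x,
      adj e f -> (forall t, sval e = [set x; t] -> P t) ->
      forall t, sval f = [set x; t] -> P t.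
    move=> e f /link_adj[p [q [w [ep fq sq]]]] hp t; rewrite fq => /set2_injr <-.
    by apply: hP sq _; apply: hp.
  by apply => // t /set2_injr <-.
apply/connectedP; split; first by exists (link_vertex xy0).
move=> P hP e f.
have [y [xy ->]] := link_vertexP e; have [z [xz ->]] := link_vertexP f.
(* A link vertex carries a proof of adjacency; [Q] quantifies over it, and proof irrelevance
   identifies the results. *)
move=> Py; pose Q t := exists xt : adj x t, P (link_vertex xt).
have [||t] := h Q _ y z xy xz; [|by exists xy|]; last first.
  by rewrite (Prop_irrelevance t xz).
move=> p q w sq [xp Pp]; case: (sq) => [[_ xq _ _] _]; exists xq; apply: hP Pp.
by apply/link_adj; exists p, q, w.
Qed.

Lemma link_bipartiteP x : bipartite (Link x) <->
  exists c : G -> bool, forall y z w, square y x z w -> c y <> c z.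
Proof.
split=> [[c hc]|[c hc]].
  exists (fun y => `[< exists e : Link x, sval e = [set x; y] /\ c e >]).
  have cE (e : Link x) y : sval e = [set x; y] ->
      `[< exists e' : Link x, sval e' = [set x; y] /\ c e' >] = c e.
    move=> ey; apply/asboolP/idP => [[e' [ey' ce']]|ce]; last by exists e.
    by rewrite (sval_inj (etrans ey (esym ey'))).
  move=> y z w sq; case: (sq) => [[yx xz _ _] _].
  rewrite (cE (link_vertex (adj_sym yx))) // (cE (link_vertex xz)) //.
  by apply: hc; apply/link_adj; exists y, z, w.
exists (fun e : Link x => `[< exists y, sval e = [set x; y] /\ c y >]).
have cE (e : Link x) y : sval e = [set x; y] ->
    `[< exists y, sval e = [set x; y] /\ c y >] = c y.
  move=> ey; apply/asboolP/idP => [[y' []]|cy]; last by exists y.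
  by rewrite ey => /set2_injr ->.
by move=> e f /link_adj[y [z [w [ey fz sq]]]]; rewrite (cE e y) // (cE f z) //; apply: hc sq.
Qed.

Lemma complex_link_adj (e f : complex_Link G) : adj e f <-> exists x y z w,
  [/\ sval e = [set x; y], sval f = [set x; z] & square y x z w].
Proof.
split=> [[nef [x [ex fx]] hef]|[x [y [z [w [ee ef sq]]]]]].
  exists x; exact: (common_cell_square (svalP e) (svalP f) nef ex fx).
have [h1 h2] := square_common_cell sq.
by rewrite /adj /= ee ef; split=> //; exists x; split; left.
Qed.

Lemma complex_link_bipartiteP : bipartite (complex_Link G) <->
  exists c : G -> G -> bool, square_colouring c.
Proof.
split=> [[c hc]|[c [cs hc]]].
  pose c' x y := `[< exists e : complex_Link G, sval e = [set x; y] /\ c e >].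
  have cE (e : complex_Link G) x y : sval e = [set x; y] -> c' x y = c e.
    move=> ey; apply/asboolP/idP => [[e' [ey' ce']]|ce]; last by exists e.
    by rewrite (sval_inj (etrans ey (esym ey'))).
  exists c'; split=> [x y|y x z w sq]; first by rewrite /c' setUC.
  case: (sq) => [[yx xz _ _] _].
  have e1 : edge [set x; y] by exists x, y; split; first exact: adj_sym.
  have e2 : edge [set x; z] by exists x, z.
  rewrite (cE (exist _ _ e1)) /=; last exact: setUC.
  rewrite (cE (exist _ _ e2)) //.
  by apply: hc; apply/complex_link_adj; exists x, y, z, w.
exists (fun e : complex_Link G =>
  `[< exists x y, sval e = [set x; y] /\ c x y >]).
have cE (e : complex_Link G) x y : sval e = [set x; y] ->
    `[< exists x y, sval e = [set x; y] /\ c x y >] = c x y.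
  move=> ey; apply/asboolP/idP => [[x' [y' []]]|cy]; last by exists x, y.
  by rewrite ey => /set2_eq[[-> ->]//|[-> ->]]; rewrite cs.
move=> e f /complex_link_adj[x [y [z [w [ey fz sq]]]]].
by rewrite (cE e x y) // (cE f x z) // cs; apply: hc sq.
Qed.

(** The link at a vertex carries [Q] around its star, and a shared edge carries it to the next star.
    Having a general [Q] lets the lemma serve both the complex link and [Inc G]. *)
Lemma edges_connected : connected G -> (forall x, link_connected x) ->
  forall Q : G -> G -> Prop, (forall x y, Q x y -> Q y x) ->
  (forall x y z w, square y x z w -> Q x y -> Q x z) ->
  forall x y u v, adj x y -> adj u v -> Q x y -> Q u v.
Proof.
move=> /connectedP[_ hG] hL Q Qsym Qsq x y u v xy uv Qxy.
have star p q r : adj p q -> adj p r -> Q p q -> Q p r.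
  by move=> pq pr; apply: (hL p (Q p)) => // a b w sq; apply: Qsq sq.
apply: (hG (fun p => forall q, adj p q -> Q p q) _ x u _ v uv); last first.
  by move=> q xq; apply: star xy xq Qxy.
move=> p q pq hp r qr; apply: (star q p) => //; first exact: adj_sym.
by apply/Qsym/hp.
Qed.

Lemma complex_link_connected : connected G -> at_least_three_vertices G ->
  (forall x, link_connected x) -> connected (complex_Link G).
Proof.
move=> hG h3 hL; apply/connectedP; split.
  have [x _] := hG.1; have [y xy] := has_neighbour hG x h3.
  have e1 : edge [set x; y] by exists x, y.
  by exists (exist _ _ e1).
move=> P hP [e [x [y [xy ee]]]] [f [u [v [uv ef]]]] Pe.
pose Q x y := exists h : @edge G [set x; y], P (exist _ _ h).
have [|||h] := edges_connected hG hL (Q := Q) _ _ xy uv.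
- by move=> a b [h Ph]; rewrite /Q setUC; exists h.
- move=> a b d w sq [h Ph]; case: (sq) => [[_ ad _ _] _].
  have h' : edge [set a; d] by exists a, d.
  exists h'; apply: hP Ph; apply/complex_link_adj.
  by exists a, b, d, w.
- by subst e; exists (ex_intro _ x (ex_intro _ y (conj xy erefl))).
by subst f => Ph; rewrite (Prop_irrelevance (ex_intro _ u _) h).
Qed.

End Links.

(** * Separation by a vertex and the incompatibility graph *)


Section LinkSeparation.
Variables (G : sgraph) (mG : median_graph G).
Implicit Types x y z u v w : G.

Let hG : connected G := mG.1.

(* The neighbours of x on geodesics from x to a fixed w span a complete subgraph
   of Link x, so every w <> x belongs to a definite component of Link x, and
   adjacent vertices other than x belong to the same one. *)
Lemma link_separation x (P : G -> Prop) p q :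
  (forall y z w, square y x z w -> P y -> P z) ->
  adj x p -> adj x q -> P p -> ~ P q ->
  exists K : set G, [/\ K p, ~ K q
    & forall u v, adj u v -> u <> x -> v <> x -> K u -> K v].
Proof.
move=> hP xp xq Pp Pq.
have uniq w y z : adj x y -> adj x z -> interval x w y -> interval x w z ->
    P y -> P z.
  move=> xy xz iy iz Py; case: (pselect (y = z)) => [<- //|nyz].
  rewrite !(interval_sym hG x) /interval /= in iy iz.
  rewrite (adj_dist hG (adj_sym xy)) addn1 in iy.
  rewrite (adj_dist hG (adj_sym xz)) addn1 in iz.
  have [t [sq _ _]] := quadrangle mG (adj_sym xy) xz nyz iy iz.
  exact: hP sq Py.
exists [set w | exists y, [/\ adj x y, interval x w y & P y]]; split.
- by exists p; rewrite /interval /= distxx addn0.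
- case=> y [xy]; rewrite /interval /= (adj_dist hG xq) (adj_dist hG xy).
  move=> e; have -> : y = q by apply: (dist_eq0 hG); lia.
  by [].
move=> u v uv nu nv [y [xy iy Py]].
have [e|e] := adj_parity mG x uv.
  case ev: (dist x v) => [|n]; first by case: nv; rewrite (dist_eq0 hG ev).
  have [z xz ez] := dist_step hG ev; exists z; split=> //.
    by rewrite /interval /= ev ez (adj_dist hG xz).
  apply: (uniq u y z) => //.
  rewrite /interval /= (adj_dist hG xz); have := dist_tri hG v z u.
  have := dist_tri hG z x u.
  by rewrite (adj_dist hG xz) (adj_dist hG (adj_sym uv)); lia.
exists y; split=> //; have iu : interval x v u.
  by rewrite /interval /= (adj_dist hG uv); lia.
by have [] := interval_trans hG iu iy.
Qed.

Lemma two_connected_link : two_connected G -> forall x, link_connected x.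
Proof.
move=> [_ _ h2] x P hP p q xp xq Pp; apply: contrapT => Pq.
have [K [Kp Kq hK]] := link_separation hP xp xq Pp Pq.
have np : p <> x by apply: nesym; apply: adj_neq xp.
have nq : q <> x by apply: nesym; apply: adj_neq xq.
pose K' (w : induced [set~ x]) := K (sval w).
have /connectedP[_ /(_ K') h] := h2 x; apply: Kq.
apply: (h _ (exist _ p np) (exist _ q nq)) => //.
by move=> [u nu] [v nv] uv; apply: hK.
Qed.

Lemma convex_walk (A P : set G) : convex A ->
  (forall u v, adj u v -> A u -> A v -> P u -> P v) ->
  forall u v, A u -> A v -> P u -> P v.
Proof.
move=> cA hP u v; move e: (dist u v) => n; elim: n u e => [|n IHn] u e Au Av.
  by rewrite (dist_eq0 hG e).
have [z uz ez] := dist_step hG e.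
have Az : A z by apply: (cA u v) => //; rewrite /interval /= e ez (adj_dist hG uz).
by move=> Pu; apply: (IHn z) => //; apply: hP Pu.
Qed.

(** A vertex of [A] nearer to [y] than to [x] would have [y] between itself and [x], against
    convexity; likewise for the complement. Any crossing edge thus determines the split. *)
Lemma halfspace_nearer (A : set G) x y : halfspace A -> adj x y -> A x -> ~ A y ->
  A = nearer x y.
Proof.
move=> [cA cB] xy Ax Ay; have xy1 := adj_dist hG xy; have S := dist_sym hG.
have yx1 := adj_dist hG (adj_sym xy).
apply/seteqP; split=> z; rewrite /nearer /=.
  move=> Az; have [e|->//] := adj_parity mG z xy; case: Ay.
  by apply: (cA z x) => //; rewrite /interval /= yx1; lia.
move=> nz; apply: contrapT => Az; apply: (cB z y) Ax => //.
by have := adj_parity mG z xy; rewrite /interval /= xy1; lia.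
Qed.

Lemma edge_convex_split x y : adj x y ->
  convex_split [set nearer x y; nearer y x].
Proof.
move=> xy; exists (nearer x y), (nearer y x); rewrite -(nearer_compl mG xy).
have [nx ny] := nearer_self mG xy; split=> //.
- by split; [exists x|exists y].
- exact: setICr.
- exact: setUv.
- exact: nearer_halfspace.
Qed.

Definition edge_split x y (xy : adj x y) : Inc G :=
  exist _ _ (edge_convex_split xy).

Lemma split_edge (S : Inc G) : exists x y (xy : adj x y), S = edge_split xy.
Proof.
case: S => S hS; case: (hS) => A [B [eS [[a Aa] [b Bb]] AB0 ABT [cA cB]]].
have eB : B = ~` A.
  apply/seteqP; split=> z; first by move=> Bz Az; have : (A `&` B) z; [split|rewrite AB0].
  by move=> nA; have : [set: G] z by []; rewrite -ABT => -[].
have hA : halfspace A by split=> //; rewrite -eB.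
have [x [y [xy [Ax Ay]]]] : exists x y, adj x y /\ A x /\ ~ A y.
  apply: contrapT => h; have : A b; last by rewrite eB in Bb.
  have /connectedP[_ hc] := hG; apply: (hc A _ a) => // u v uv Au.
  by apply: contrapT => Av; apply: h; exists u, v.
exists x, y, xy; apply: eq_exist.
by rewrite eS eB (halfspace_nearer hA xy Ax Ay) (nearer_compl mG xy).
Qed.

Lemma edge_split_sym x y (xy : adj x y) (yx : adj y x) :
  edge_split xy = edge_split yx.
Proof. by apply: eq_exist; rewrite setUC. Qed.

Lemma edge_split_adj x y u v (xy : adj x y) (uv : adj u v) :
  adj (edge_split xy) (edge_split uv) <->
  [/\ nearer x y `&` nearer u v !=set0, nearer x y `&` nearer v u !=set0,
      nearer y x `&` nearer u v !=set0 & nearer y x `&` nearer v u !=set0].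
Proof.
rewrite /adj /=; split=> [h|[h1 h2 h3 h4] A B [] -> [] ->] //.
by split; apply: h; [left|left|left|right|right|left|right|right].
Qed.

(** The four corners of the square lie one in each of the four intersections. *)
Lemma square_edge_split_adj x y z w (xy : adj x y) (xz : adj x z) :
  square y x z w -> adj (edge_split xy) (edge_split xz).
Proof.
move=> sq; case: (sq) => [[yx _ zw wy] [nyz nxw ayz axw]]; apply/edge_split_adj.
have yz2 := dist2 mG yx xz nyz; have zy2 := dist2 mG (adj_sym xz) xy (nesym nyz).
have xw2 := dist2 mG xz zw nxw.
have wx2 := dist2 mG (adj_sym zw) (adj_sym xz) (nesym nxw).
have d1 := adj_dist hG; split; [exists x|exists z|exists y|exists w].
all: rewrite /nearer; split=> /=; rewrite ?distxx ?yz2 ?zy2 ?wx2 ?d1 //.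
all: exact: adj_sym.
Qed.

(** A half that avoids [x] is convex, so it lies inside the separated set [K] or misses it. Halves
    of incompatible splits intersect, so this alternative is constant on [Inc G]; yet it differs for
    the splits of [x p] and [x q]. *)
Lemma inc_link_connected : connected (Inc G) -> forall x, link_connected x.
Proof.
move=> /connectedP[_ hI] x P hP p q xp xq Pp; apply: contrapT => Pq.
have [K [Kp Kq hK]] := link_separation hP xp xq Pp Pq.
pose Q (S : Inc G) := exists A, [/\ sval S A, ~ A x & exists2 w, A w & K w].
have [np nx] := nearer_self mG (adj_sym xp).
have [nq nx'] := nearer_self mG (adj_sym xq).
have /hI/(_ (edge_split xp) (edge_split xq)) h S S' : adj S S' -> Q S -> Q S'.
  move=> SS' [A [SA nAx [w Aw Kw]]].
  have [A' S'A' nA'x] : exists2 A', sval S' A' & ~ A' x.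
    have [u [v [uv ->]]] := split_edge S'; rewrite /= -(nearer_compl mG uv).
    case: (pselect (nearer u v x)) => h; last by exists (nearer u v) => //; left.
    by exists (~` nearer u v); [right|exact].
  exists A'; split=> //; have [t [At A't]] := SS' _ _ SA S'A'; exists t => //.
  have cA : convex A.
    have [u [v [uv eS]]] := split_edge S; rewrite eS in SA.
    by case: SA => ->; apply: nearer_convex => //; apply: adj_sym.
  apply: (convex_walk cA _ Aw At Kw) => a b ab Aa Ab.
  by apply: hK => // e; apply: nAx; rewrite -e.
have [|A [[] -> nA [w Aw Kw]]] := h.
- by exists (nearer p x); split=> //; [right|exists p].
- by have [] := nearer_self mG xq.
apply: Kq; apply: (convex_walk (nearer_convex mG (adj_sym xq)) _ Aw nq Kw).
by move=> a b ab Aa Ab; apply: hK => // e; apply: nA; rewrite -[X in nearer _ _ X]e.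
Qed.

Lemma link_bipartite_inc x : bipartite (Inc G) -> bipartite (Link x).
Proof.
move=> [c hc]; apply/link_bipartiteP.
exists (fun y => `[< exists xy : adj x y, c (edge_split xy) >]).
have cE y (xy : adj x y) : `[< exists xy : adj x y, c (edge_split xy) >] =
    c (edge_split xy).
  apply/asboolP/idP => [[xy']|cy]; last by exists xy.
  by rewrite (Prop_irrelevance xy' xy).
move=> y z w sq; case: (sq) => [[yx xz _ _] _].
by rewrite (cE _ (adj_sym yx)) (cE _ xz); apply: hc; apply: square_edge_split_adj sq.
Qed.

Lemma inc_connected : at_least_three_vertices G ->
  (forall x, link_connected x) -> connected (Inc G).
Proof.
move=> h3 hL; apply/connectedP; split.
  have [x _] := hG.1; have [y xy] := has_neighbour hG x h3.
  by exists (edge_split xy).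
move=> P hP S S'.
have [x [y [xy ->]]] := split_edge S; have [u [v [uv ->]]] := split_edge S'.
move=> PS; pose Q x y := exists xy : adj x y, P (edge_split xy).
have [|||uv' h] := edges_connected hG hL (Q := Q) _ _ xy uv.
- move=> a b [ab h]; exists (adj_sym ab).
  by rewrite (edge_split_sym (adj_sym ab) ab).
- move=> a b d w sq [ab h]; case: (sq) => [[_ ad _ _] _]; exists ad.
  by apply: hP h; apply: square_edge_split_adj sq.
- by exists xy.
by rewrite (Prop_irrelevance uv uv').
Qed.

(* On the ladder of squares across uv, from an edge on one side of xy to an edge
   on the other side, some square has to cross xy. *)
Lemma incompatible_colour (c : G -> G -> bool) x y u v (xy : adj x y)
    (uv : adj u v) : square_colouring c ->
  adj (edge_split xy) (edge_split uv) -> c x y <> c u v.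
Proof.
move=> hc /edge_split_adj[]; rewrite -(nearer_compl mG xy) -(nearer_compl mG uv).
move=> [a1 [H1 K1]] [a2 [H2 K2]] [b1 [H3 K3]] [b2 [H4 K4]] e.
have [cH cH'] := nearer_halfspace mG xy.
set H := nearer x y in cH cH' H1 H2 H3 H4; set K := nearer u v in K1 K2 K3 K4.
have cross (A : set G) s t : convex A -> A s -> A t -> K s -> ~ K t ->
    exists p q, [/\ adj p q, A p, A q, K p & ~ K q].
  move=> cA As At Ks Kt; apply: contrapT => h; apply: Kt.
  apply: (convex_walk cA _ As At Ks) => p q pq Ap Aq Kp.
  by apply: contrapT => Kq; apply: h; exists p, q.
have [a [a' [aa' Ha Ha' Ka Ka']]] := cross _ _ _ cH H1 H2 K1 K2.
have [b [b' [bb' Hb Hb' Kb Kb']]] := cross _ _ _ cH' H3 H4 K3 K4.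
(* Only edges of colour [c x y] cross [H]. If [u v] had that colour too, the rails of the ladder
   across [K] would have the other one and could never leave [H], although [b] is outside. *)
have stay p q : adj p q -> c p q <> c x y -> H p -> H q.
  move=> pq cpq Hp; apply: contrapT => Hq; apply: cpq.
  by have [] := crossing_colour mG hc xy erefl pq Hp Hq.
apply: Hb; apply: proj1 _.
apply: (ladder mG (A := K) (P := fun p q => H p /\ H q)
  (nearer_halfspace mG uv) _ aa' Ka Ka' bb' Kb Kb') => //.
move=> p q p' q' sq Kp Kp' Kq Kq' [Hp Hq]; case: (sq) => [[pq qq' _ p'p] _].
have [cpq _ _] := crossing_colour mG hc uv erefl pq Kp Kq.
have n1 := hc.2 _ _ _ _ sq.
have n2 := hc.2 _ _ _ _ (square_rot (square_rot (square_rot sq))).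
split; last by apply: (stay q) => //; rewrite e -cpq; apply: nesym.
by apply: (stay p) => //; [exact: adj_sym|rewrite hc.1 e -cpq].
Qed.

(** All edges across a split have the same colour by [crossing_colour], so the split inherits it. *)
Lemma inc_bipartite (c : G -> G -> bool) :
  square_colouring c -> bipartite (Inc G).
Proof.
move=> hc; exists (fun S : Inc G =>
  `[< exists x y (xy : adj x y), S = edge_split xy /\ c x y >]).
have cE x y (xy : adj x y) : `[< exists u v (uv : adj u v),
    edge_split xy = edge_split uv /\ c u v >] = c x y.
  apply/asboolP/idP => [[u [v [uv [/(congr1 sval) /= e]]]]|cxy]; last by exists x, y, xy.
  have : [set nearer u v; nearer v u] (nearer x y) by rewrite -e; left.
  have [nu nv] := nearer_self mG uv; have [nv' nu'] := nearer_self mG (adj_sym uv).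
  case=> /= en; rewrite -en in nu nv nu' nv'.
    by have [-> _ _] := crossing_colour mG hc xy erefl uv nu nv.
  have [<- _ _] := crossing_colour mG hc xy erefl (adj_sym uv) nv' nu'.
  by rewrite hc.1.
move=> S S'; have [x [y [xy ->]]] := split_edge S.
have [u [v [uv ->]]] := split_edge S'; rewrite !cE.
exact: incompatible_colour.
Qed.

(* The colourings of the links are glued along geodesics from a base vertex. *)
Lemma square_colouring_of_links : (forall x : G, bipartite (Link x)) ->
  exists c : G -> G -> bool, square_colouring c.
Proof.
move=> hL; have /choice[e he] x : exists c : G -> bool,
  forall y z w, square y x z w -> c y <> c z by apply/link_bipartiteP.
have [o _] := hG.1.
have [|s [_ hs]] := integrate mG false
    (step := fun y x b => b (+) (e x y (+) e y x)) (o := o).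
  (* [s x] tells whether to flip the colouring [e x]. At each of the four corners of a square the
     two link colours differ, so the eight values add up to zero modulo 2 and both routes agree. *)
  move=> x y z w sq _ _ b.
  have h1 := he _ _ _ _ sq; have h2 := he _ _ _ _ (square_rot sq).
  have h3 := he _ _ _ _ (square_rot (square_rot sq)).
  have h4 := he _ _ _ _ (square_rot (square_rot (square_rot sq))).
  move: h1 h2 h3 h4; case: (e x y); case: (e x z) => //; case: (e y x);
  case: (e y w) => //; case: (e z x); case: (e z w) => //; case: (e w y);
  by case: (e w z); case: b.
have sE x y : adj x y -> s x (+) e x y = s y (+) e y x.
  move=> xy; have [d|d] := adj_parity mG o xy.
    rewrite (hs x y) //; last exact: adj_sym.
    by case: (s y); case: (e x y); case: (e y x).
  by rewrite (hs y x) //; case: (s x); case: (e x y); case: (e y x).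
exists (fun x y => `[< adj x y >] && (s x (+) e x y)); split=> [x y|x y z w sq].
  case: asboolP => xy; case: asboolP => yx //; first exact: sE.
  - by case: yx; apply: adj_sym.
  - by case: xy; apply: adj_sym.
case: (sq) => [[xy yz _ _] _]; rewrite !asboolT //= (sE x y) //.
by have := he _ _ _ _ sq; case: (s y); case: (e y x); case: (e y z).
Qed.

End LinkSeparation.

(* The edges meeting a union of components of G - v can be recoloured
   independently of the others. *)
Lemma unique_embedding_two_connected (G : sgraph) : connected G ->
  at_least_three_vertices G -> partial_double_tree G ->
  unique_minimal_embedding G -> two_connected G.
Proof.
move=> hG h3 [T1 [T2 [h1 h2 [f hf]]]] hu; split=> // v.
have mG := embedding_median_graph hG h1 h2 hf.
have hc := embedding_square_colouring hG h1 h2 hf.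
set c := edge_colour f in hc.
apply/connectedP; split.
  have [y vy] := has_neighbour hG v h3.
  have ny : y <> v by apply: nesym; apply: adj_neq vy.
  by exists (exist _ y ny).
move=> P hP [p np] [q nq] Pp; apply: contrapT => Pq.
pose K w := exists h : w <> v, P (exist _ w h).
have Kp : K p by exists np.
have Kq : ~ K q by case=> h; rewrite (Prop_irrelevance h nq).
have hK a b : adj a b -> b <> v -> K a -> K b.
  by move=> ab nb [na Pa]; exists nb; apply: hP Pa.
pose inK a b := `[< K a \/ K b >].
pose c' a b := c a b (+) inK a b.
have inKC a b : inK a b = inK b a by rewrite /inK; congr asbool; rewrite propeqE; tauto.
have hc' : square_colouring c'.
  split=> [a b|a b d e sq]; first by rewrite /c' hc.1 inKC.
  (* All edges of a square are flipped or none: if [b] is not [v], membership of [b] in [K] decides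
     for both edges; if [b = v], then [a], [e], [d] form a path avoiding [v]. *)
  have := hc.2 _ _ _ _ sq; rewrite /c'; suff -> : inK a b = inK b d.
    by case: (c a b); case: (c b d); case: (inK b d).
  have [[ab bd de ea] [nad nbe _ _]] := sq.
  congr asbool; rewrite propeqE.
  case: (pselect (b = v)) => [bv|nb]; last first.
    have Ka := hK _ _ ab nb; have Kd := hK _ _ (adj_sym bd) nb; tauto.
  have Kb : ~ K b by rewrite bv => -[].
  have nv t : b <> t -> t <> v by rewrite -bv => h1' h2'; apply: h1'.
  have na := nv _ (nesym (adj_neq ab)); have nd := nv _ (adj_neq bd).
  have ne := nv _ nbe.
  have A1 := hK _ _ de ne; have A2 := hK _ _ ea na.
  have A3 := hK _ _ (adj_sym ea) ne; have A4 := hK _ _ (adj_sym de) nd.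
  tauto.
have [S1 [S2 [g [t1 t2 hg ecg]]]] := coordinatization mG hc.
have [S1' [S2' [g' [t1' t2' hg' ecg']]]] := coordinatization mG hc'.
have := equivalent_same_colour hG t1 t2 hg (hu _ _ _ _ t1 t2 t1' t2' g g' hg hg').
(* The new colouring differs from [c] on an edge at [p] and agrees with it on an edge at [q], so it
   is neither [c] nor its swap. *)
case=> h.
  have [p' pp'] := has_neighbour hG p h3; have := h _ _ pp'.
  rewrite ecg // ecg' // /c' /inK asboolT; last by left.
  by case: (c p p').
have [q' qq'] := has_neighbour hG q h3; have := h _ _ qq'.
rewrite ecg // ecg' // /c' /inK asboolF; first by case: (c q q').
by case=> // Kq'; apply/Kq/(hK q') => //; exact: adj_sym.
Qed.

Theorem corollary1 (G : sgraph) (hconn : connected G)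
    (hthree : at_least_three_vertices G) :
  [<-> partial_double_tree G /\ unique_minimal_embedding G;
       two_connected G /\
         (exists T1 T2 : sgraph,
           [/\ tree T1, tree T2 & median_subgraph G (cartesian T1 T2)]);
       median_graph G /\ bipartite (Inc G) /\ connected (Inc G);
       median_graph G /\
         (forall x : G, bipartite (Link x) /\ connected (Link x));
       median_graph G /\
         bipartite (complex_Link G) /\ connected (complex_Link G)].
Proof.
have nbr x := has_neighbour hconn x hthree.
tfae.
- move=> [hp hu]; split; first exact: unique_embedding_two_connected.
  have [T1 [T2 [h1 h2 [f hf]]]] := hp; exists T1, T2; split=> //.
  exact: embedding_median_subgraph hf.
- move=> [h2c [T1 [T2 [h1 h2 [f [hf _]]]]]].
  have mG := embedding_median_graph hconn h1 h2 hf; split=> //; split.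
    exact: (inc_bipartite mG (embedding_square_colouring hconn h1 h2 hf)).
  by apply: inc_connected => //; apply: two_connected_link.
- move=> [mG [hb hi]]; split=> // x; split; first exact: link_bipartite_inc.
  by apply/(link_connectedP (nbr x)); apply: inc_link_connected.
- move=> [mG hL]; split=> //; split.
    apply/complex_link_bipartiteP; apply: square_colouring_of_links => // x.
    by have [] := hL x.
  apply: complex_link_connected => // x.
  by apply/(link_connectedP (nbr x)); have [] := hL x.
move=> [mG [/complex_link_bipartiteP[c hc] hL]]; split.
  have [T1 [T2 [f [h1 h2 [hf _ _] _]]]] := coordinatization mG hc.
  by exists T1, T2; split=> //; exists f.
move=> T1 T2 T1' T2' h1 h2 h1' h2' f f' hf hf'.
apply: same_colour_equivalent => //.
have [c1s hc1] : square_colouring (edge_colour f).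
  by case: hf => hf _ _; apply: embedding_square_colouring.
have [c2s hc2] : square_colouring (edge_colour f').
  by case: hf' => hf' _ _; apply: embedding_square_colouring.
have /connectedP[_ hP] := hL.
(* Both colourings change between adjacent edges of the link graph, so their sum modulo 2 is
   constant; its value [b] is read off at one edge and decides whether the factors are swapped. *)
have prop (b : bool) (e e' : complex_Link G) :
    (forall x y, sval e = [set x; y] ->
      edge_colour f' x y = b (+) edge_colour f x y) ->
    forall x y, sval e' = [set x; y] ->
      edge_colour f' x y = b (+) edge_colour f x y.
  move: e e'; apply: hP => e e' /complex_link_adj[x [y [z [w [ee ee' sq]]]]] h u v.
  rewrite ee' => /set2_eq euv.
  have -> : edge_colour f' u v = edge_colour f' x z by case: euv => -[-> ->].
  have -> : edge_colour f u v = edge_colour f x z by case: euv => -[-> ->].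
  have := h _ _ ee; have := hc1 _ _ _ _ sq; have := hc2 _ _ _ _ sq.
  rewrite (c1s y) (c2s y); case: b {h}; case: (edge_colour f' x y);
  by case: (edge_colour f x y); case: (edge_colour f' x z); case: (edge_colour f x z).
have [x0 _] := hconn.1; have [y0 xy0] := nbr x0.
have edgeI (x y : G) : adj x y -> edge [set x; y] by move=> xy; exists x, y.
have start b : edge_colour f' x0 y0 = b (+) edge_colour f x0 y0 ->
    forall x y, adj x y -> edge_colour f' x y = b (+) edge_colour f x y.
  move=> e0 x y xy; pose e : complex_Link G := exist _ _ (edgeI _ _ xy0).
  pose e' : complex_Link G := exist _ _ (edgeI _ _ xy).
  apply: (prop b e e' _ x y erefl) => u v /set2_eq[[<- <-] //|[<- <-]].
  by rewrite c1s c2s.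
case e0: (edge_colour f' x0 y0 == edge_colour f x0 y0).
  by left; apply: (start false); rewrite (eqP e0).
right; apply: (start true); move: e0.
by case: (edge_colour f' x0 y0); case: (edge_colour f x0 y0).
Qed.
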